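(* Let $\lambda\in X$. Then $L(\lambda)$, together with its weight decomposition and the homomorphisms $E_{\mu,\alpha,n}\colon L(\lambda)_\mu\to L(\lambda)_{\mu+n\alpha}$ and $F_{\mu,\alpha,n}\colon L(\lambda)_{\mu+n\alpha}\to L(\lambda)_\mu$ ($\mu\in X$, $\alpha\in\Pi$, $n>0$) given by the action of the standard generators $e_\alpha^{[n]}$ and $f_\alpha^{[n]}$ of $U$, is an object in $\mathcal X$. It is isomorphic to $S(\lambda)$.
   Context: $R$ is a simply laced root system (i.e. $\langle\alpha,\beta^\vee\rangle\in\{0,-1\}$ for $\alpha\ne\beta$ in the basis) with basis $\Pi$ and weight lattice $X$; $\alpha^\vee$ is the coroot of $\alpha$. Partial order on $X$: $\mu\le\lambda$ iff $\lambda-\mu$ is a (possibly empty) sum of elements of $\Pi$. A subset $T\subset X$ is quasi-bounded (from above) if for all $\mu\in X$ the set $\{\lambda\in T\mid\mu\le\lambda\}$ is finite. $K$ is a field and $q\in K^\times$ is an arbitrary invertible element. Quantum numbers: in $\mathcal Z:=\mathbb Z[v,v^{-1}]$ set $[n]=\frac{v^n-v^{-n}}{v-v^{-1}}$ for $n\in\mathbb Z$, and for $a,b\in\mathbb Z$ let ${a\brack b}=\frac{[a][a-1]\cdots[a-b+1]}{[1][2]\cdots[b]}\in\mathcal Z$ if $b>0$, ${a\brack 0}=1$, and ${a\brack b}=0$ if $b<0$. These are also regarded as elements of $K$ via $v\mapsto q$. The category $\mathcal X=\mathcal X_{(K,q)}$: objects are $X$-graded $K$-vector spaces $M=\bigoplus_{\mu\in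 X}M_\mu$ with $K$-linear operators $E_{\alpha,n}=E_{\mu,\alpha,n}\colon M_\mu\to M_{\mu+n\alpha}$ and $F_{\alpha,n}=F_{\mu,\alpha,n}\colon M_{\mu+n\alpha}\to M_\mu$ for all $\mu\in X$, $\alpha\in\Pi$, $n>0$ (with $E_{\mu,\alpha,0}=F_{\mu,\alpha,0}=\operatorname{id}_{M_\mu}$ and $E_{\mu,\alpha,n}=F_{\mu,\alpha,n}=0$ for $n<0$), such that: (X1) The set of $\mu$ with $M_\mu\ne0$ is quasi-bounded from above and each $M_\mu$ is finite dimensional. (X2) For all $\mu\in X$, $\alpha,\beta\in\Pi$, $m,n>0$ and $v\in M_{\mu+n\beta}$: $E_{\alpha,m}F_{\beta,n}(v)=F_{\beta,n}E_{\alpha,m}(v)$ if $\alpha\ne\beta$, and $E_{\alpha,m}F_{\alpha,n}(v)=\sum_{r\in\mathbb Z}{\langle\mu,\alpha^\vee\rangle+m+n\brack r}F_{\alpha,n-r}E_{\alpha,m-r}(v)$ if $\alpha=\beta$. (X3) For all $\mu\in X$: $M_\mu=\ker E_\mu\oplus\operatorname{im}F_\mu$, where $M_{\delta\mu}:=\bigoplus_{\alpha\in\Pi,n>0}M_{\mu+n\alpha}$, $E_\mu\colon M_\mu\to M_{\delta\mu}$ has components $E_{\mu,\alpha,n}$, and $F_\mu\colon M_{\delta\mu}\to M_\mu$ is $(v_{\mu+n\alpha})\mapsto\sum_{\alpha,n}F_{\mu,\alpha,n}(v_{\mu+n\alpha})$. Morphisms are grading-preserving $K$-linear maps commuting with all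 $E$- and $F$-operators. For $\lambda\in X$, $S(\lambda)$ denotes the up to isomorphism unique object of $\mathcal X$ that is indecomposable, with $\dim_KS(\lambda)_\lambda=1$, and such that $S(\lambda)_\mu\neq0$ implies $\mu\le\lambda$. The quantum group: $U_{\mathcal Z}$ is Lusztig's quantum group over $\mathcal Z$ with divided powers associated with the Cartan matrix $(\langle\alpha,\beta^\vee\rangle)_{\alpha,\beta\in\Pi}$. Explicitly, it is the $\mathcal Z$-subalgebra generated by $e_\alpha^{[n]}=e_\alpha^n/([1]\cdots[n])$, $f_\alpha^{[n]}=f_\alpha^n/([1]\cdots[n])$, $k_\alpha^{\pm1}$ ($\alpha\in\Pi$, $n>0$) of the $\mathbb Q(v)$-algebra with generators $e_\alpha,f_\alpha,k_\alpha^{\pm1}$ and relations: the $k_\alpha$ commute, $k_\alpha k_\alpha^{-1}=1$, $k_\alpha e_\beta k_\alpha^{-1}=v^{\langle\beta,\alpha^\vee\rangle}e_\beta$, $k_\alpha f_\beta k_\alpha^{-1}=v^{-\langle\beta,\alpha^\vee\rangle}f_\beta$, $e_\alpha f_\beta-f_\beta e_\alpha=\delta_{\alpha\beta}\frac{k_\alpha-k_\alpha^{-1}}{v-v^{-1}}$, and the quantum Serre relations ($e_\alpha e_\beta=e_\beta e_\alpha$ if $\langle\alpha,\beta^\vee\rangle=0$, $e_\alpha^2e_\beta-[2]e_\alpha e_\beta e_\alpha+e_\beta e_\alpha^2=0$ if $\langle\alpha,\beta^\vee\rangle=-1$, and likewise for the $f$'s). It contains ${k_\alpha\brack n}=\prod_{s=1}^n\frac{k_\alpha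 v^{-s+1}-k_\alpha^{-1}v^{s-1}}{v^s-v^{-s}}$. Let $U^0_{\mathcal Z}$ be the unital subalgebra generated by all $k_\alpha^{\pm1}$ and ${k_\alpha\brack n}$, and set $U=U_{\mathcal Z}\otimes_{\mathcal Z}K$, $U^0=U^0_{\mathcal Z}\otimes_{\mathcal Z}K$ via $v\mapsto q$. Every $\mu\in X$ yields a character $\chi_\mu\colon U^0\to K$ with $k_\alpha^{\pm1}\mapsto q^{\pm\langle\mu,\alpha^\vee\rangle}$ and ${k_\alpha\brack r}\mapsto{\langle\mu,\alpha^\vee\rangle\brack r}$ ($\alpha\in\Pi$, $r\ge0$). A $U$-module $M$ is a weight module if $M=\bigoplus_{\mu\in X}M_\mu$ with $M_\mu=\{m\in M\mid H.m=\chi_\mu(H)m\text{ for all }H\in U^0\}$. $L(\lambda)$ is the (up to isomorphism unique) irreducible $U$-module of highest weight $\lambda$, i.e. the irreducible weight module generated by a non-zero vector in $L(\lambda)_\lambda$ annihilated by all $e_\alpha^{[n]}$, $n>0$. *)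

(* Defs.v *)
From HB Require Import structures.
From mathcomp Require Import all_boot all_order all_algebra.
From mathcomp Require Import boolp classical_sets cardinality.

Set Implicit Arguments.
Unset Strict Implicit.
Unset Printing Implicit Defensive.

Import Order.TTheory GRing.Theory Num.Theory.
Local Open Scope ring_scope.
Local Open Scope quotient_scope.

(* A reduced crystallographic root system with a chosen basis, realised over
   the rationals.  Outside [rs_roots] the value of [rs_coroot] is irrelevant. *)
Record rootSystem := RootSystem {
  rs_space :> vectType rat;
  rs_roots : seq rs_space;
  rs_coroot : rs_space -> 'Hom(rs_space, rat^o);
  rs_span : <<rs_roots>>%VS = fullv;
  rs_neq0 : 0 \notin rs_roots;
  rs_coroot2 : {in rs_roots, forall a, rs_coroot a a = 2};
  rs_reflect : {in rs_roots &, forall a b, b - rs_coroot a b *: a \in rs_roots};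
  rs_integral : {in rs_roots &, forall a b, rs_coroot a b \is a Num.int};
  rs_reduced : forall a (c : rat),
    a \in rs_roots -> c *: a \in rs_roots -> c = 1 \/ c = -1;
  rs_base : seq rs_space;
  rs_base_roots : {subset rs_base <= rs_roots};
  rs_base_free : free rs_base;
  rs_base_sign : {in rs_roots, forall b, exists c : rs_space -> nat,
    b = \sum_(a <- rs_base) (c a)%:R *: a \/
    b = - \sum_(a <- rs_base) (c a)%:R *: a}
}.

Section Weights.
Variable RS : rootSystem.

Definition is_weight : pred RS :=
  fun x => all (fun a => rs_coroot a x \is a Num.int) (rs_roots RS).

Record weight := Weight { wval : RS; _ : is_weight wval }.
HB.instance Definition _ := [isSub for wval].
HB.instance Definition _ := [Choice of weight by <:].

Fact is_weight_zmod_closed : zmod_closed is_weight.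
Proof.
split=> [|x y /allP hx /allP hy]; apply/allP => a ra; first by rewrite linear0 rpred0.
by rewrite linearB rpredB ?hx ?hy.
Qed.
HB.instance Definition _ := GRing.isZmodClosed.Build RS is_weight is_weight_zmod_closed.
HB.instance Definition _ := [SubChoice_isSubZmodule of weight by <:].

Definition simple := seq_sub (rs_base RS).
HB.instance Definition _ := Finite.on simple.

Fact simple_is_weight (a : simple) : is_weight (ssval a).
Proof.
by apply/allP => b rb; apply: rs_integral => //; apply: rs_base_roots; apply: ssvalP.
Qed.
Definition sroot (a : simple) : weight := Weight (simple_is_weight a).

(* The value of the coroot on a weight is an integer, so [floor] only changes
   its type. *)
Definition pairing (x : weight) (a : simple) : int :=
  Num.floor (rs_coroot (ssval a) (wval x) : rat).

Definition simply_laced := forall a b : simple,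
  a != b -> pairing (sroot a) b = 0 \/ pairing (sroot a) b = -1.

Definition le_weight (mu lam : weight) :=
  exists c : simple -> nat, lam - mu = \sum_a sroot a *+ c a.

Definition quasi_bounded (T : set weight) := forall mu : weight,
  finite_set (fun lam => T lam /\ le_weight mu lam).

End Weights.

Notation Qv := {fraction {poly rat}}.
Definition vv : Qv := tofrac 'X.

Definition qint (n : int) : Qv := (vv ^ n - vv ^ (- n)) / (vv - vv^-1).

Definition qfact (n : nat) : Qv := \prod_(1 <= s < n.+1) qint s%:Z.

Definition qbin (a b : int) : Qv :=
  match b with
  | Posz n => (\prod_(0 <= i < n) qint (a - i%:Z)) / qfact n
  | Negz _ => 0
  end.

(* Z[v, v^-1], as a subset of Q(v). *)
Definition laurent : set Qv := fun z =>
  exists (p : {poly int}) (n : nat), z = (map_poly intr p).[vv] / vv ^+ n.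

(* The specialisation Z[v, v^-1] -> K, v |-> q, extended by 0 to Q(v). *)
Definition ev (K : fieldType) (q : K) (z : Qv) : K :=
  xget 0 (fun c => exists (p : {poly int}) (n : nat),
    z = (map_poly intr p).[vv] / vv ^+ n /\ c = (map_poly intr p).[q] / q ^+ n).

Lemma horner_vv (p : {poly int}) :
  (map_poly intr p).[vv] = tofrac (map_poly intr p).
Proof.
elim/poly_ind: p => [|p c IH]; first by rewrite !rmorph0 horner0.
rewrite !rmorphD !rmorphM /= !map_polyX !map_polyC !hornerE /= IH; congr (_ + _).
by rewrite !rmorph_int.
Qed.

Lemma vv_neq0 : vv != 0.
Proof. by rewrite /vv tofrac_eq0 polyX_eq0. Qed.

Lemma evE (K : fieldType) (q : K) (p : {poly int}) (n : nat) : q != 0 ->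
  ev q ((map_poly intr p).[vv] / vv ^+ n) = (map_poly intr p).[q] / q ^+ n.
Proof.
move=> q0; rewrite /ev; apply: xget_unique; first by exists p, n.
move=> _ [p' [n' [e ->]]]; apply/eqP.
rewrite eqr_div ?expf_neq0 //; move/eqP: e; rewrite eqr_div ?expf_neq0 ?vv_neq0 //.
rewrite !horner_vv -!rmorphXn -!rmorphM tofrac_eq => /eqP e.
have {}e : p * 'X^n' = p' * 'X^n.
  apply: (map_inj_poly (f := intr : int -> rat) (@intr_inj _) (erefl _)).
  by rewrite !rmorphM /= !map_polyXn.
have {e} : (map_poly (intr : int -> K) (p * 'X^n')).[q] = (map_poly intr (p' * 'X^n)).[q].
  by rewrite e.
by rewrite !rmorphM /= !map_polyXn !hornerE => ->.
Qed.

Inductive term (k G : Type) :=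
  | TGen of G
  | TZero
  | TOne
  | TAdd of term k G & term k G
  | TOpp of term k G
  | TMul of term k G & term k G
  | TScale of k & term k G.
Arguments TZero {k G}.
Arguments TOne {k G}.
Arguments TGen {k G} _.

HB.instance Definition _ (k G : Type) := gen_eqMixin (term k G).
HB.instance Definition _ (k G : Type) := gen_choiceMixin (term k G).

Section Presented.
Variables (k : comPzRingType) (G : Type) (rel : term k G -> term k G -> Prop).

(* The smallest congruence containing [rel] modulo which terms form an
   associative unital k-algebra. *)
Inductive cong : term k G -> term k G -> Prop :=
  | cong_rel x y : rel x y -> cong x y
  | cong_refl x : cong x x
  | cong_sym x y : cong x y -> cong y x
  | cong_trans x y z : cong x y -> cong y z -> cong x z
  | cong_add x x' y y' : cong x x' -> cong y y' -> cong (TAdd x y) (TAdd x' y')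
  | cong_opp x x' : cong x x' -> cong (TOpp x) (TOpp x')
  | cong_mul x x' y y' : cong x x' -> cong y y' -> cong (TMul x y) (TMul x' y')
  | cong_scale c x x' : cong x x' -> cong (TScale c x) (TScale c x')
  | cong_addA x y z : cong (TAdd x (TAdd y z)) (TAdd (TAdd x y) z)
  | cong_addC x y : cong (TAdd x y) (TAdd y x)
  | cong_add0 x : cong (TAdd TZero x) x
  | cong_addN x : cong (TAdd (TOpp x) x) TZero
  | cong_mulA x y z : cong (TMul x (TMul y z)) (TMul (TMul x y) z)
  | cong_mul1l x : cong (TMul TOne x) x
  | cong_mul1r x : cong (TMul x TOne) x
  | cong_mulDl x y z : cong (TMul (TAdd x y) z) (TAdd (TMul x z) (TMul y z))
  | cong_mulDr x y z : cong (TMul x (TAdd y z)) (TAdd (TMul x y) (TMul x z))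
  | cong_scaleA c d x : cong (TScale c (TScale d x)) (TScale (c * d) x)
  | cong_scale1 x : cong (TScale 1 x) x
  | cong_scaleDr c x y : cong (TScale c (TAdd x y)) (TAdd (TScale c x) (TScale c y))
  | cong_scaleDl c d x : cong (TScale (c + d) x) (TAdd (TScale c x) (TScale d x))
  | cong_scaleAl c x y : cong (TScale c (TMul x y)) (TMul (TScale c x) y)
  | cong_scaleAr c x y : cong (TScale c (TMul x y)) (TMul x (TScale c y)).

Definition congb x y := `[< cong x y >].
Fact congb_equiv : equiv_class_of congb.
Proof.
split=> [x|x y|y x z].
- by apply/asboolP; apply: cong_refl.
- by apply/asboolP/asboolP; apply: cong_sym.
- by move=> /asboolP h /asboolP h'; apply/asboolP; apply: cong_trans h h'.
Qed.
Canonical congb_equivRel := EquivRelPack congb_equiv.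

Definition presalg := {eq_quot congb_equivRel}.
HB.instance Definition _ := Choice.on presalg.
HB.instance Definition _ := EqQuotient.on presalg.

Definition pcl (t : term k G) : presalg := \pi_presalg t.

Lemma pcl_eq x y : pcl x = pcl y <-> cong x y.
Proof. by split=> [/eqquotP/asboolP|h] //; apply/eqquotP/asboolP. Qed.

Lemma repr_cong x : cong (repr (pcl x)) x.
Proof. by apply/pcl_eq; rewrite /pcl reprK. Qed.

Lemma pclW (P : presalg -> Prop) : (forall t, P (pcl t)) -> forall x, P x.
Proof. by move=> h x; rewrite -[x]reprK; apply: h. Qed.

Definition padd (x y : presalg) := pcl (TAdd (repr x) (repr y)).
Definition popp (x : presalg) := pcl (TOpp (repr x)).
Definition pmul (x y : presalg) := pcl (TMul (repr x) (repr y)).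
Definition pscale c (x : presalg) := pcl (TScale c (repr x)).

Lemma paddE x y : padd (pcl x) (pcl y) = pcl (TAdd x y).
Proof. by apply/pcl_eq/cong_add; apply: repr_cong. Qed.
Lemma poppE x : popp (pcl x) = pcl (TOpp x).
Proof. by apply/pcl_eq/cong_opp; apply: repr_cong. Qed.
Lemma pmulE x y : pmul (pcl x) (pcl y) = pcl (TMul x y).
Proof. by apply/pcl_eq/cong_mul; apply: repr_cong. Qed.
Lemma pscaleE c x : pscale c (pcl x) = pcl (TScale c x).
Proof. by apply/pcl_eq/cong_scale; apply: repr_cong. Qed.
Let pE := (paddE, poppE, pmulE, pscaleE).

Fact paddA : associative padd.
Proof. by elim/pclW=> x; elim/pclW=> y; elim/pclW=> z; rewrite !pE; apply/pcl_eq/cong_addA. Qed.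
Fact paddC : commutative padd.
Proof. by elim/pclW=> x; elim/pclW=> y; rewrite !pE; apply/pcl_eq/cong_addC. Qed.
Fact padd0 : left_id (pcl TZero) padd.
Proof. by elim/pclW=> x; rewrite !pE; apply/pcl_eq/cong_add0. Qed.
Fact paddN : left_inverse (pcl TZero) popp padd.
Proof. by elim/pclW=> x; rewrite !pE; apply/pcl_eq/cong_addN. Qed.
Fact pmulA : associative pmul.
Proof. by elim/pclW=> x; elim/pclW=> y; elim/pclW=> z; rewrite !pE; apply/pcl_eq/cong_mulA. Qed.
Fact pmul1l : left_id (pcl TOne) pmul.
Proof. by elim/pclW=> x; rewrite !pE; apply/pcl_eq/cong_mul1l. Qed.
Fact pmul1r : right_id (pcl TOne) pmul.
Proof. by elim/pclW=> x; rewrite !pE; apply/pcl_eq/cong_mul1r. Qed.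
Fact pmulDl : left_distributive pmul padd.
Proof. by elim/pclW=> x; elim/pclW=> y; elim/pclW=> z; rewrite !pE; apply/pcl_eq/cong_mulDl. Qed.
Fact pmulDr : right_distributive pmul padd.
Proof. by elim/pclW=> x; elim/pclW=> y; elim/pclW=> z; rewrite !pE; apply/pcl_eq/cong_mulDr. Qed.
HB.instance Definition _ := GRing.isPzRing.Build presalg
  paddA paddC padd0 paddN pmulA pmul1l pmul1r pmulDl pmulDr.

Fact pscaleA a b x : pscale a (pscale b x) = pscale (a * b) x.
Proof. by elim/pclW: x => x; rewrite !pE; apply/pcl_eq/cong_scaleA. Qed.
Fact pscale1 : left_id 1 pscale.
Proof. by elim/pclW=> x; rewrite !pE; apply/pcl_eq/cong_scale1. Qed.
Fact pscaleDr : right_distributive pscale +%R.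
Proof.
by move=> a; elim/pclW=> x; elim/pclW=> y; rewrite /+%R/= !pE; apply/pcl_eq/cong_scaleDr.
Qed.
Fact pscaleDl x : {morph pscale^~ x : a b / a + b}.
Proof.
by move=> a b; elim/pclW: x => x; rewrite [RHS]/+%R/= !pE; apply/pcl_eq/cong_scaleDl.
Qed.
HB.instance Definition _ := GRing.Zmodule_isLmodule.Build k presalg
  pscaleA pscale1 pscaleDr pscaleDl.

Lemma presalg_scaleAl (c : k) (x y : presalg) : c *: (x * y) = (c *: x) * y.
Proof.
elim/pclW: x => x; elim/pclW: y => y.
by rewrite /*:%R/= /*%R/= !pE; apply/pcl_eq/cong_scaleAl.
Qed.
Lemma presalg_scaleAr (c : k) (x y : presalg) : c *: (x * y) = x * (c *: y).
Proof.
elim/pclW: x => x; elim/pclW: y => y.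
by rewrite /*:%R/= /*%R/= !pE; apply/pcl_eq/cong_scaleAr.
Qed.

End Presented.

Section QuantumGroup.
Variable RS : rootSystem.
Local Notation simple := (simple RS).

Inductive qgen := Ge of simple | Gf of simple | Gk of simple | Gki of simple.

Definition te a : term Qv qgen := TGen (Ge a).
Definition tf a : term Qv qgen := TGen (Gf a).
Definition tk a : term Qv qgen := TGen (Gk a).
Definition tki a : term Qv qgen := TGen (Gki a).
Local Notation "x ** y" := (TMul x y) (at level 40, left associativity).
Local Notation "x +++ y" := (TAdd x y) (at level 50, left associativity).
Local Notation "x --- y" := (TAdd x (TOpp y)) (at level 50, left associativity).
Local Notation "c *^ y" := (TScale c y) (at level 38, right associativity).

(* [cart b a] is the Cartan integer <b, a^vee>. *)
Local Notation cart b a := (pairing (sroot b) a).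

Inductive qrel : term Qv qgen -> term Qv qgen -> Prop :=
  | qrel_kk a b : qrel (tk a ** tk b) (tk b ** tk a)
  | qrel_kki a : qrel (tk a ** tki a) TOne
  | qrel_kik a : qrel (tki a ** tk a) TOne
  | qrel_ke a b : qrel (tk a ** te b ** tki a) (vv ^ cart b a *^ te b)
  | qrel_kf a b : qrel (tk a ** tf b ** tki a) (vv ^ (- cart b a) *^ tf b)
  | qrel_ef a b : a != b -> qrel (te a ** tf b --- tf b ** te a) TZero
  | qrel_efk a : qrel (te a ** tf a --- tf a ** te a) ((vv - vv^-1)^-1 *^ (tk a --- tki a))
  | qrel_e0 a b : cart a b = 0 -> qrel (te a ** te b) (te b ** te a)
  | qrel_e1 a b : cart a b = -1 ->
      qrel (te a ** te a ** te b --- qint 2 *^ (te a ** te b ** te a) +++ te b ** te a ** te a) TZero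
  | qrel_f0 a b : cart a b = 0 -> qrel (tf a ** tf b) (tf b ** tf a)
  | qrel_f1 a b : cart a b = -1 ->
      qrel (tf a ** tf a ** tf b --- qint 2 *^ (tf a ** tf b ** tf a) +++ tf b ** tf a ** tf a) TZero.

Definition UQ := presalg qrel.
HB.instance Definition _ := GRing.PzRing.on UQ.
HB.instance Definition _ := GRing.Lmodule.on UQ.

Definition qe (a : simple) : UQ := pcl qrel (te a).
Definition qf (a : simple) : UQ := pcl qrel (tf a).
Definition qk (a : simple) : UQ := pcl qrel (tk a).
Definition qki (a : simple) : UQ := pcl qrel (tki a).

Definition qe_dp (a : simple) (n : nat) : UQ := (qfact n)^-1 *: qe a ^+ n.
Definition qf_dp (a : simple) (n : nat) : UQ := (qfact n)^-1 *: qf a ^+ n.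

Definition qk_bin (a : simple) (n : nat) : UQ :=
  \prod_(1 <= s < n.+1) ((vv ^+ s - vv ^- s)^-1 *:
     (vv ^ (1 - s%:Z) *: qk a - vv ^ (s%:Z - 1) *: qki a)).

(* The unital Z[v, v^-1]-subalgebra of [UQ] generated by [G]. *)
Inductive zgen (G : set UQ) : UQ -> Prop :=
  | zgen_in x : G x -> zgen G x
  | zgen_one : zgen G 1
  | zgen_add x y : zgen G x -> zgen G y -> zgen G (x + y)
  | zgen_mul x y : zgen G x -> zgen G y -> zgen G (x * y)
  | zgen_scale z x : laurent z -> zgen G x -> zgen G (z *: x).

Lemma laurent_int (m : int) : laurent m%:~R.
Proof. by exists m%:P, 0%N; rewrite expr0 divr1 map_polyC hornerC. Qed.

Lemma zgen_subset (G G' : set UQ) :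
  (forall x, G x -> zgen G' x) -> forall x, zgen G x -> zgen G' x.
Proof.
move=> sub x; elim=> {x} [x /sub //||x y _ + _|x y _ + _|z x hz _].
- exact: zgen_one.
- exact: zgen_add.
- exact: zgen_mul.
- exact: zgen_scale.
Qed.

Section Subalgebra.
Variable G : set UQ.
Definition zgenb : pred UQ := fun x => `[< zgen G x >].

Record zalg := ZAlg { zval : UQ; _ : zgenb zval }.
HB.instance Definition _ := [isSub for zval].
HB.instance Definition _ := [Choice of zalg by <:].

Fact zgenb_subring : subring_closed zgenb.
Proof.
split=> [|x y /asboolP hx /asboolP hy|x y /asboolP hx /asboolP hy]; apply/asboolP.
- exact: zgen_one.
- apply: zgen_add => //; rewrite -scaleN1r; apply: zgen_scale => //.
  exact: (laurent_int (-1)).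
- exact: zgen_mul.
Qed.
HB.instance Definition _ := GRing.isSubringClosed.Build UQ zgenb zgenb_subring.
HB.instance Definition _ := GRing.SubChoice_isSubPzRing.Build UQ zgenb zalg zgenb_subring.

Lemma zvalP (x : zalg) : zgen G (zval x).
Proof. by apply/asboolP; case: x. Qed.

Lemma zvalM (x y : zalg) : zval (x * y) = zval x * zval y.
Proof. exact: (rmorphM (val : zalg -> UQ)). Qed.

Definition zelt (x : UQ) (hx : zgen G x) : zalg := @ZAlg x (asboolT hx).

Variables (K : fieldType) (q : K).

(* The base change along v |-> q of the subalgebra generated by G, i.e. its
   tensor product with K over Z[v, v^-1], as formal sums modulo bilinearity:
   [:: (u1, c1); ...; (un, cn)] stands for the sum of the u_i (x) c_i. *)
Inductive tcong : seq (zalg * K) -> seq (zalg * K) -> Prop :=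
  | tcong_refl s : tcong s s
  | tcong_sym s t : tcong s t -> tcong t s
  | tcong_trans s t r : tcong s t -> tcong t r -> tcong s r
  | tcong_cat s s' t t' : tcong s s' -> tcong t t' -> tcong (s ++ t)%SEQ (s' ++ t')%SEQ
  | tcong_swap s t : tcong (s ++ t)%SEQ (t ++ s)%SEQ
  | tcong_0 c : tcong [:: (0, c)] [::]
  | tcong_Dl u u' c : tcong [:: (u + u', c)] [:: (u, c); (u', c)]
  | tcong_Dr u c c' : tcong [:: (u, c + c')] [:: (u, c); (u, c')]
  | tcong_bal z u w c : laurent z -> zval w = z *: zval u ->
      tcong [:: (w, c)] [:: (u, ev q z * c)].

Definition tcongb s t := `[< tcong s t >].
Fact tcongb_equiv : equiv_class_of tcongb.
Proof.
split=> [x|x y|y x z].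
- by apply/asboolP; apply: tcong_refl.
- by apply/asboolP/asboolP; apply: tcong_sym.
- by move=> /asboolP h /asboolP h'; apply/asboolP; apply: tcong_trans h h'.
Qed.
Canonical tcongb_equivRel := EquivRelPack tcongb_equiv.

Definition zalgK := {eq_quot tcongb_equivRel}.
HB.instance Definition _ := Choice.on zalgK.
HB.instance Definition _ := EqQuotient.on zalgK.

Definition tcl (s : seq (zalg * K)) : zalgK := \pi_zalgK s.
Definition pure (u : zalg) (c : K) : zalgK := tcl [:: (u, c)].

Lemma tcl_eq x y : tcl x = tcl y <-> tcong x y.
Proof. by split=> [/eqquotP/asboolP|h] //; apply/eqquotP/asboolP. Qed.

Lemma repr_tcong x : tcong (repr (tcl x)) x.
Proof. by apply/tcl_eq; rewrite /tcl reprK. Qed.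

Lemma tclW (P : zalgK -> Prop) : (forall t, P (tcl t)) -> forall x, P x.
Proof. by move=> h x; rewrite -[x]reprK; apply: h. Qed.

Lemma tcong_cons x s t : tcong s t -> tcong (x :: s) (x :: t).
Proof. by move=> h; apply: (@tcong_cat [:: x] [:: x]) => //; apply: tcong_refl. Qed.

Lemma tcong_perm s t : perm_eq s t -> tcong s t.
Proof.
elim: s t => [|x s IH] t.
  by rewrite perm_sym => /perm_nilP ->; apply: tcong_refl.
move=> h; have /path.splitPr xt : x \in t by rewrite -(perm_mem h) mem_head.
case: xt h => t1 t2; rewrite perm_sym perm_catC /= perm_cons perm_catC perm_sym => /IH h.
apply: tcong_trans (tcong_cons x h) _.
rewrite -[x :: _]/(([:: x] ++ t1) ++ t2)%SEQ -[t1 ++ x :: t2]/(t1 ++ [:: x] ++ t2)%SEQ catA.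
by apply: tcong_cat; [apply: tcong_swap | apply: tcong_refl].
Qed.

Definition tmap (g : zalg -> zalg) (h : K -> K) (s : seq (zalg * K)) :=
  [seq (g x.1, h x.2) | x <- s].

Definition sopp := tmap -%R id.
Definition sscale (c : K) := tmap id ( *%R c).
Definition smul (s t : seq (zalg * K)) := [seq (x.1 * y.1, x.2 * y.2) | x <- s, y <- t].

Lemma tmap_cong g h : {morph g : u v / u + v} -> {morph h : c d / c + d} ->
  (forall z c, h (ev q z * c) = ev q z * h c) ->
  (forall z u w, laurent z -> zval w = z *: zval u -> zval (g w) = z *: zval (g u)) ->
  forall s t, tcong s t -> tcong (tmap g h s) (tmap g h t).
Proof.
move=> gD hD hev gbal s t; have g0 : g 0 = 0.
  by apply: (addrI (g 0)); rewrite -gD !addr0.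
elim=> {s t} [s|s t _|s t r _ + _|s s' t t' _ + _|s t|c|u u' c|u c c'|z u w c hz hw] /=.
- exact: tcong_refl.
- exact: tcong_sym.
- exact: tcong_trans.
- by rewrite /tmap !map_cat; apply: tcong_cat.
- by rewrite /tmap !map_cat; apply: tcong_swap.
- by rewrite g0; apply: tcong_0.
- by rewrite gD; apply: tcong_Dl.
- by rewrite hD; apply: tcong_Dr.
- by rewrite hev; apply: tcong_bal => //; apply: gbal.
Qed.

Lemma sopp_cong s t : tcong s t -> tcong (sopp s) (sopp t).
Proof.
apply: tmap_cong => //; first by move=> ? ?; rewrite opprD.
by move=> z u w _ e; rewrite !raddfN /= e.
Qed.

Lemma sscale_cong c s t : tcong s t -> tcong (sscale c s) (sscale c t).
Proof.
apply: tmap_cong => //; first by move=> ? ?; rewrite mulrDr.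
by move=> z d; rewrite mulrCA.
Qed.

Lemma sscale_cat c s t : sscale c (s ++ t)%SEQ = (sscale c s ++ sscale c t)%SEQ.
Proof. exact: map_cat. Qed.

Lemma lmul_cong x s t : tcong s t -> 
  tcong (tmap ( *%R x.1) ( *%R x.2) s) (tmap ( *%R x.1) ( *%R x.2) t).
Proof.
apply: tmap_cong => [? ?|? ?|z d|z u w _ e]; rewrite ?mulrDr //; first by rewrite mulrCA.
by rewrite !zvalM e presalg_scaleAr.
Qed.

Lemma rmul_cong y s t : tcong s t -> 
  tcong (tmap ( *%R^~ y.1) ( *%R^~ y.2) s) (tmap ( *%R^~ y.1) ( *%R^~ y.2) t).
Proof.
apply: tmap_cong => [? ?|? ?|z d|z u w _ e]; rewrite ?mulrDl //; first by rewrite mulrA.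
by rewrite !zvalM e presalg_scaleAl.
Qed.

Lemma smul_consl x s t : smul (x :: s) t = (tmap ( *%R x.1) ( *%R x.2) t ++ smul s t)%SEQ.
Proof. by []. Qed.

Lemma smul_consr s y t :
  tcong (smul s (y :: t)) (tmap ( *%R^~ y.1) ( *%R^~ y.2) s ++ smul s t)%SEQ.
Proof.
by apply/tcong_perm/permPl; apply: (perm_allpairs_consr _ _ (fun=> y) (fun=> t)).
Qed.

Lemma smul_cong s s' t t' : tcong s s' -> tcong t t' -> tcong (smul s t) (smul s' t').
Proof.
move=> hs ht; apply: (@tcong_trans _ (smul s t')).
  elim: s {hs} => [|x s IH]; first exact: tcong_refl.
  by rewrite !smul_consl; apply: tcong_cat => //; apply: lmul_cong.
elim: t' {ht} => [|y t' IH].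
  by rewrite /smul !allpairs0r; apply: tcong_refl.
apply: tcong_trans (smul_consr _ _ _) _.
apply: tcong_trans (tcong_sym (smul_consr _ _ _)).
by apply: tcong_cat => //; apply: rmul_cong.
Qed.

Definition tadd (x y : zalgK) := tcl (repr x ++ repr y)%SEQ.
Definition topp (x : zalgK) := tcl (sopp (repr x)).
Definition tmul (x y : zalgK) := tcl (smul (repr x) (repr y)).
Definition tscale c (x : zalgK) := tcl (sscale c (repr x)).

Lemma taddE x y : tadd (tcl x) (tcl y) = tcl (x ++ y)%SEQ.
Proof. by apply/tcl_eq/tcong_cat; apply: repr_tcong. Qed.
Lemma toppE x : topp (tcl x) = tcl (sopp x).
Proof. by apply/tcl_eq/sopp_cong; apply: repr_tcong. Qed.
Lemma tmulE x y : tmul (tcl x) (tcl y) = tcl (smul x y).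
Proof. by apply/tcl_eq/smul_cong; apply: repr_tcong. Qed.
Lemma tscaleE c x : tscale c (tcl x) = tcl (sscale c x).
Proof. by apply/tcl_eq/sscale_cong; apply: repr_tcong. Qed.
Let tE := (taddE, toppE, tmulE, tscaleE).

Fact taddA : associative tadd.
Proof. by elim/tclW=> x; elim/tclW=> y; elim/tclW=> z; rewrite !tE catA. Qed.
Fact taddC : commutative tadd.
Proof. by elim/tclW=> x; elim/tclW=> y; rewrite !tE; apply/tcl_eq/tcong_swap. Qed.
Fact tadd0 : left_id (tcl [::]) tadd.
Proof. by elim/tclW=> x; rewrite !tE. Qed.
Fact taddN : left_inverse (tcl [::]) topp tadd.
Proof.
elim/tclW=> x; rewrite !tE; apply/tcl_eq; elim: x => [|[u c] x IH]; first exact: tcong_refl.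
apply: (@tcong_trans _ ([:: (- u, c); (u, c)] ++ (sopp x ++ x))%SEQ).
  by apply: tcong_perm; rewrite /= perm_cons perm_catC /= perm_cons perm_catC.
apply: (@tcong_cat _ [::] _ [::]) => //; apply: tcong_trans (tcong_sym (tcong_Dl _ _ _)) _.
by rewrite addNr; apply: tcong_0.
Qed.
Fact tmulA : associative tmul.
Proof.
elim/tclW=> x; elim/tclW=> y; elim/tclW=> z; rewrite !tE; congr tcl.
elim: x => // a x IH; rewrite !smul_consl /smul allpairs_cat -!/(smul _ _) IH.
congr cat; elim: y {IH} => // b y IH; rewrite !smul_consl /tmap map_cat -!/(tmap _ _ _) IH.
congr cat; rewrite /tmap -map_comp; apply: eq_map => c /=; by rewrite !mulrA.
Qed.
Fact tmul1l : left_id (pure 1 1) tmul.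
Proof.
elim/tclW=> x; rewrite tE smul_consl cats0; congr tcl.
by rewrite /tmap -[RHS]map_id; apply: eq_map => -[u c]; rewrite !mul1r.
Qed.
Fact tmul1r : right_id (pure 1 1) tmul.
Proof.
elim/tclW=> x; rewrite tE; congr tcl; rewrite /smul allpairs1r -[RHS]map_id.
by apply: eq_map => -[u c]; rewrite !mulr1.
Qed.
Fact tmulDl : left_distributive tmul tadd.
Proof.
by elim/tclW=> x; elim/tclW=> y; elim/tclW=> z; rewrite !tE /smul allpairs_cat.
Qed.
Fact tmulDr : right_distributive tmul tadd.
Proof.
elim/tclW=> x; elim/tclW=> y; elim/tclW=> z; rewrite !tE; apply/tcl_eq/tcong_perm/permPl.
exact: (perm_allpairs_catr _ _ (fun=> _) (fun=> _)).
Qed.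
HB.instance Definition _ := GRing.isPzRing.Build zalgK
  taddA taddC tadd0 taddN tmulA tmul1l tmul1r tmulDl tmulDr.

Fact tscaleA a b x : tscale a (tscale b x) = tscale (a * b) x.
Proof.
elim/tclW: x => x; rewrite !tE /sscale /tmap -map_comp; congr tcl.
by apply: eq_map => -[u c] /=; rewrite mulrA.
Qed.
Fact tscale1 : left_id 1 tscale.
Proof.
elim/tclW=> x; rewrite !tE; congr tcl; rewrite -[RHS]map_id.
by apply: eq_map => -[u c] /=; rewrite mul1r.
Qed.
Fact tscaleDr : right_distributive tscale +%R.
Proof.
by move=> a; elim/tclW=> x; elim/tclW=> y; rewrite /+%R/= !tE /sscale /tmap map_cat.
Qed.
Fact tscaleDl x : {morph tscale^~ x : a b / a + b}.
Proof.
move=> a b; elim/tclW: x => x; rewrite [RHS]/+%R/= !tE; apply/tcl_eq.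
elim: x => [|[u c] x IH]; first exact: tcong_refl.
apply: (@tcong_trans _ ([:: (u, a * c); (u, b * c)] ++ (sscale a x ++ sscale b x))%SEQ).
  by apply: (@tcong_cat [:: _]) => //; rewrite /= mulrDl; apply: tcong_Dr.
apply: tcong_perm; rewrite /= perm_cons perm_sym perm_catC /= perm_cons perm_catC.
exact: perm_refl.
Qed.
HB.instance Definition _ := GRing.Zmodule_isLmodule.Build K zalgK
  tscaleA tscale1 tscaleDr tscaleDl.

Lemma zalgK_scaleAl (c : K) (x y : zalgK) : c *: (x * y) = (c *: x) * y.
Proof.
elim/tclW: x => x; elim/tclW: y => y; rewrite /*:%R/= /*%R/= !tE; congr tcl.
elim: x => // a x IH; rewrite smul_consl sscale_cat IH.
rewrite -[sscale c (a :: x)]/((a.1, c * a.2) :: sscale c x) smul_consl.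
by congr cat; rewrite /sscale /tmap -map_comp; apply: eq_map => b /=; rewrite mulrA.
Qed.
Lemma zalgK_scaleAr (c : K) (x y : zalgK) : c *: (x * y) = x * (c *: y).
Proof.
elim/tclW: x => x; elim/tclW: y => y; rewrite /*:%R/= /*%R/= !tE; congr tcl.
elim: x => // a x IH; rewrite !smul_consl sscale_cat IH.
by congr cat; rewrite /sscale /tmap -!map_comp; apply: eq_map => b /=; rewrite mulrCA.
Qed.

End Subalgebra.

Definition zalgK_incl (G G' : set UQ) (sub : forall x, zgen G x -> zgen G' x)
    (K : fieldType) (q : K) (x : zalgK G q) : zalgK G' q :=
  tcl q [seq (zelt (sub _ (zvalP y.1)), y.2) | y <- repr x].

Definition UZ_gens : set UQ := fun x => exists a : simple,
  [\/ exists2 n, (0 < n)%N & x = qe_dp a n,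
      exists2 n, (0 < n)%N & x = qf_dp a n, x = qk a | x = qki a].

(* All k_a, k_a^-1 and [k_a; n] lie in U_Z, so the membership condition removes
   nothing; it makes the inclusion of U^0_Z into U_Z immediate. *)
Definition U0Z_gens : set UQ := fun x => zgen UZ_gens x /\
  exists a : simple, [\/ x = qk a, x = qki a | exists n, x = qk_bin a n].

Lemma U0Z_sub x : zgen U0Z_gens x -> zgen UZ_gens x.
Proof. by apply: zgen_subset => {}x []. Qed.

Lemma UZ_e a n : zgen UZ_gens (qe_dp a n).
Proof.
case: n => [|n]; last by apply: zgen_in; exists a; apply: Or41; exists n.+1.
by rewrite /qe_dp /qfact big_geq // invr1 scale1r; apply: zgen_one.
Qed.

Lemma UZ_f a n : zgen UZ_gens (qf_dp a n).
Proof.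
case: n => [|n]; last by apply: zgen_in; exists a; apply: Or42; exists n.+1.
by rewrite /qf_dp /qfact big_geq // invr1 scale1r; apply: zgen_one.
Qed.

Variables (K : fieldType) (q : K).

Definition Uq := zalgK UZ_gens q.
HB.instance Definition _ := GRing.PzRing.on Uq.
HB.instance Definition _ := GRing.Lmodule.on Uq.

Definition Uq0 := zalgK U0Z_gens q.
HB.instance Definition _ := GRing.PzRing.on Uq0.
HB.instance Definition _ := GRing.Lmodule.on Uq0.

Definition U0_incl (H : Uq0) : Uq := zalgK_incl U0Z_sub H.
Definition Ue (a : simple) (n : nat) : Uq := pure q (zelt (UZ_e a n)) 1.
Definition Uf (a : simple) (n : nat) : Uq := pure q (zelt (UZ_f a n)) 1.

Definition is_chi (mu : weight RS) (chi : Uq0 -> K) : Prop :=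
  [/\ scalar chi, GRing.monoid_morphism chi &
    forall (a : simple) (x : zalg U0Z_gens),
      [/\ zval x = qk a -> chi (pure q x 1) = q ^ pairing mu a,
          zval x = qki a -> chi (pure q x 1) = q ^ (- pairing mu a) &
          forall r : nat, zval x = qk_bin a r ->
            chi (pure q x 1) = ev q (qbin (pairing mu a) r)]].

(* For q <> 0 exactly one character satisfies [is_chi mu]; [xget] selects it. *)
Definition chi (mu : weight RS) : Uq0 -> K := xget (fun=> 0) (is_chi mu).

Section Umodule.
Variable L : lmodType Uq.

(* L as a K-vector space, through K -> U. *)
Definition resK : Type := L.
HB.instance Definition _ := GRing.Zmodule.on resK.
Definition resK_scale (c : K) (m : resK) : resK := (c *: (1 : Uq)) *: (m : L).
Fact resK_scaleA a b m : resK_scale a (resK_scale b m) = resK_scale (a * b) m.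
Proof. by rewrite /resK_scale scalerA -zalgK_scaleAl mul1r scalerA. Qed.
Fact resK_scale1 : left_id 1 resK_scale.
Proof. by move=> m; rewrite /resK_scale !scale1r. Qed.
Fact resK_scaleDr : right_distributive resK_scale +%R.
Proof. by move=> a m m'; apply: scalerDr. Qed.
Fact resK_scaleDl m : {morph resK_scale^~ m : a b / a + b}.
Proof. by move=> a b; rewrite /resK_scale !scalerDl. Qed.
HB.instance Definition _ := GRing.Zmodule_isLmodule.Build K resK
  resK_scaleA resK_scale1 resK_scaleDr resK_scaleDl.

Definition Uact (u : Uq) (m : resK) : resK := u *: (m : L).

Definition wtspace (mu : weight RS) : set resK := fun m =>
  forall H : Uq0, Uact (U0_incl H) m = chi mu H *: m.

Definition irreducible : Prop :=
  (exists m : L, m <> 0) /\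
  forall P : set L, P 0 -> (forall m m', P m -> P m' -> P (m + m')) ->
    (forall (u : Uq) m, P m -> P (u *: m)) ->
    (forall m, P m -> m = 0) \/ (forall m, P m).

End Umodule.
End QuantumGroup.

Section CategoryX.
Variables (RS : rootSystem) (K : fieldType) (q : K).
Local Notation X := (weight RS).
Local Notation Pi := (simple RS).

Definition subspace (M : lmodType K) (P : set M) :=
  P 0 /\ forall (c : K) x y, P x -> P y -> P (c *: x + y).

Definition direct_sum (M : lmodType K) (P : X -> set M) :=
  [/\ forall mu, subspace (P mu),
      forall x : M, exists (s : seq X) (y : X -> M),
        (forall mu, P mu (y mu)) /\ x = \sum_(mu <- s) y mu
    & forall (s : seq X) (y : X -> M), uniq s -> (forall mu, P mu (y mu)) ->
        \sum_(mu <- s) y mu = 0 -> {in s, forall mu, y mu = 0}].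

Definition has_dim (M : lmodType K) (P : set M) (n : nat) :=
  exists b : 'I_n -> M, (forall i, P (b i)) /\
    forall x, P x -> exists! c : {ffun 'I_n -> K}, x = \sum_i c i *: b i.

(* The family of maps E_{mu,a,n} : M_mu -> M_{mu + n a}, mu in X, is encoded as
   one operator [gE a n] on M, the direct sum of the M_mu, and similarly for F.
   Only the values at n > 0 are meaningful. *)
Record gspace := GSpace {
  gcar :> lmodType K;
  gcomp : X -> set gcar;
  gE : Pi -> nat -> gcar -> gcar;
  gF : Pi -> nat -> gcar -> gcar
}.

Definition gE0 (M : gspace) a n : M -> M := if n is 0%N then id else gE a n.
Definition gF0 (M : gspace) a n : M -> M := if n is 0%N then id else gF a n.
Arguments gE0 : clear implicits.
Arguments gF0 : clear implicits.

Definition shift (mu : X) (a : Pi) (n : nat) : X := mu + sroot a *+ n.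

Definition graded_ops (M : gspace) : Prop :=
  direct_sum (@gcomp M) /\
  forall (a : Pi) (n : nat), (0 < n)%N ->
    [/\ linear (gE a n : M -> M), linear (gF a n : M -> M),
        forall mu (x : M), gcomp mu x -> gcomp (shift mu a n) (gE a n x) &
        forall mu (x : M), gcomp (shift mu a n) x -> gcomp mu (gF a n x)].

Definition X1 (M : gspace) : Prop :=
  quasi_bounded (fun mu => exists2 x : M, gcomp mu x & x <> 0) /\
  forall mu, exists d, has_dim (@gcomp M mu) d.

(* As E_{a,n} = F_{a,n} = 0 for n < 0 and the binomial vanishes for r < 0, only
   0 <= r <= min(m, n) contribute to the sum over all integers r. *)
Definition X2 (M : gspace) : Prop :=
  forall (mu : X) (a b : Pi) (m n : nat) (x : M), (0 < m)%N -> (0 < n)%N ->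
    gcomp (shift mu b n) x ->
    (a <> b -> gE a m (gF b n x) = gF b n (gE a m x)) /\
    (a = b -> gE a m (gF a n x) =
       \sum_(0 <= r < (minn m n).+1)
          ev q (qbin (pairing mu a + m%:Z + n%:Z) r%:Z) *:
            gF0 M a (n - r) (gE0 M a (m - r) x)).

Definition kerE (M : gspace) (mu : X) : set M := fun x =>
  gcomp mu x /\ forall (a : Pi) (n : nat), (0 < n)%N -> gE a n x = 0.

(* Elements of the direct sum of the M_{mu + n a}, a in Pi, n > 0, given by their
   components; almost all of them are zero. *)
Definition delta_elt (M : gspace) (mu : X) (w : Pi -> nat -> M) (N : nat) : Prop :=
  forall (a : Pi) (n : nat), (0 < n)%N ->
    gcomp (shift mu a n) (w a n) /\ ((N < n)%N -> w a n = 0).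

Definition imF (M : gspace) (mu : X) : set M := fun x =>
  exists (w : Pi -> nat -> M) (N : nat), delta_elt mu w N /\
    x = \sum_(a : Pi) \sum_(1 <= n < N.+1) gF a n (w a n).

Definition X3 (M : gspace) : Prop := forall mu : X,
  (forall x : M, gcomp mu x <-> exists y z, [/\ kerE mu y, imF mu z & x = y + z]) /\
  (forall x : M, kerE mu x -> imF mu x -> x = 0).

Definition in_X (M : gspace) : Prop := [/\ graded_ops M, X1 M, X2 M & X3 M].

Definition X_hom (M N : gspace) (f : M -> N) : Prop :=
  [/\ linear f, forall mu x, gcomp mu x -> gcomp mu (f x) &
      forall a n x, (0 < n)%N ->
        f (gE a n x) = gE a n (f x) /\ f (gF a n x) = gF a n (f x)].

Definition X_iso (M N : gspace) : Prop :=
  exists (f : M -> N) (g : N -> M),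
    [/\ X_hom f, X_hom g, cancel f g & cancel g f].

Definition is_zero (M : gspace) : Prop := forall x : M, x = 0.

(* M is isomorphic to the direct sum of A and B in the category X. *)
Definition is_biproduct (M A B : gspace) : Prop :=
  exists (iA : A -> M) (pA : M -> A) (iB : B -> M) (pB : M -> B),
    [/\ [/\ X_hom iA, X_hom pA, X_hom iB & X_hom pB],
        cancel iA pA, cancel iB pB,
        (forall x, pA (iB x) = 0) /\ (forall x, pB (iA x) = 0) &
        forall x, iA (pA x) + iB (pB x) = x].

Definition indecomposable (M : gspace) : Prop :=
  ~ is_zero M /\
  forall A B : gspace, in_X A -> in_X B -> is_biproduct M A B ->
    is_zero A \/ is_zero B.

(* M is (a model of) S(lam), which is defined up to isomorphism by these
   properties; likewise [is_L] below for L(lam). *)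
Definition is_S (lam : X) (M : gspace) : Prop :=
  [/\ in_X M, indecomposable M, has_dim (@gcomp M lam) 1 &
      forall mu (x : M), gcomp mu x -> x <> 0 -> le_weight mu lam].

Definition gspace_of (L : lmodType (Uq RS q)) : gspace :=
  @GSpace (resK L) (@wtspace RS K q L)
    (fun a n => @Uact RS K q L (Ue q a n)) (fun a n => @Uact RS K q L (Uf q a n)).

Definition weight_module (L : lmodType (Uq RS q)) : Prop :=
  direct_sum (@wtspace RS K q L).

Definition is_L (lam : X) (L : lmodType (Uq RS q)) : Prop :=
  [/\ weight_module L, irreducible L &
      exists v : L, [/\ v <> 0, wtspace lam v,
        forall (a : Pi) (n : nat), (0 < n)%N -> Ue q a n *: v = 0 &
        forall x : L, exists u : Uq RS q, x = u *: v]].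

End CategoryX.

(* Main.v *)
Require Import Defs.
From HB Require Import structures.
From mathcomp Require Import all_boot all_order all_algebra.
From mathcomp Require Import boolp classical_sets cardinality.
From mathcomp Require Import ring.

(** Both L(lam) and S(lam) turn out to be objects of the following shape, called
   cyclic objects here ([cyclic_object]): they satisfy the commutation rule (X2),
   all their weights are below lam, they are spanned by the vectors obtained from
   one vector v of weight lam by applying divided powers F, and no nonzero vector
   of a weight other than lam is killed by all E.

   Such an object is determined up to isomorphism ([cyclic_iso]). In the product
   of two of them take the F-span of the pair of highest weight vectors. By (X2)
   it is stable under the E. If (0, y) is an element of maximal weight in it, then
   y is killed by all E; hence y = 0 unless the weight is lam, where the span is
   just a line. So the span is the graph of a map, and by symmetry of an
   isomorphism.

   A cyclic object lies in X and has the properties of S(lam) ([cyclic_in_X],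
   [cyclic_is_S]): (X3) is trivial because in weight lam there is no room for the
   image of F, while in other weights kerE is 0 and everything is in the image of
   F. Conversely every model of S(lam) is cyclic ([is_S_cyclic]): (X3) splits it
   as the F-span of its highest weight vector plus the F-span of the vectors
   killed by E in the other weights, and the latter must vanish.

   It remains to see that L(lam) is cyclic ([is_L_cyclic]). A subspace spanned by
   weight vectors and stable under all divided powers is a submodule, so
   irreducibility yields generation by v as well as the statement about kerE. The
   commutation rule (X2) is the formula for e^(m) f^(n) in the generic quantum
   group ([qe_qf_dp]), proved by induction on m and specialised to v = q. That
   formula also shows that the elements [K; c, r] belong to the integral form
   ([UZ_kbin]), and these are what is needed to see that divided powers shift
   weights. For this last point the character of the new weight must exist; it is
   read off from the action of U^0 on the shifted vector, if that is nonzero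
   ([wtvec_chi]). *)

Set Implicit Arguments.
Unset Strict Implicit.
Unset Printing Implicit Defensive.

Import Order.TTheory GRing.Theory Num.Theory.
Local Open Scope ring_scope.

(** * Laurent polynomials and their specialisation *)

Section Laurent.
Implicit Types (z : Qv) (p : {poly int}).

Lemma laurent_pair z z' : laurent z -> laurent z' -> exists p p' n,
  z = (map_poly intr p).[vv] / vv ^+ n /\ z' = (map_poly intr p').[vv] / vv ^+ n.
Proof.
move=> [p [n ->]] [p' [n' ->]]; exists (p * 'X^n'), (p' * 'X^n), (n + n')%N.
rewrite !rmorphM /= !map_polyXn !hornerE exprD !invfM; split.
  by rewrite [vv ^- n * _]mulrC mulrA mulfK ?expf_neq0 ?vv_neq0.
by rewrite mulrA mulfK ?expf_neq0 ?vv_neq0.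
Qed.

Lemma laurentD z z' : laurent z -> laurent z' -> laurent (z + z').
Proof.
move=> hz hz'; have [p [p' [n [-> ->]]]] := laurent_pair hz hz'.
by exists (p + p'), n; rewrite rmorphD hornerE mulrDl.
Qed.

Lemma laurentM z z' : laurent z -> laurent z' -> laurent (z * z').
Proof.
move=> hz hz'; have [p [p' [n [-> ->]]]] := laurent_pair hz hz'.
by exists (p * p'), (n + n)%N; rewrite rmorphM /= hornerM exprD mulrACA -invfM.
Qed.

Lemma laurentX (n : int) : laurent (vv ^ n).
Proof.
case: n => n; first by exists 'X^n, 0%N; rewrite map_polyXn hornerXn expr0 divr1.
by exists 1, n.+1; rewrite rmorph1 hornerC div1r.
Qed.

Lemma laurent0 : laurent 0. Proof. exact: (laurent_int 0). Qed.
Lemma laurent1 : laurent 1. Proof. exact: (laurent_int 1). Qed.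

Lemma laurentN z : laurent z -> laurent (- z).
Proof. by rewrite -mulN1r; apply: laurentM; apply: (laurent_int (-1)). Qed.

Variables (K : fieldType) (q : K).
Hypothesis q_neq0 : q != 0.

Lemma evD z z' : laurent z -> laurent z' -> ev q (z + z') = ev q z + ev q z'.
Proof.
move=> hz hz'; have [p [p' [n [-> ->]]]] := laurent_pair hz hz'.
by rewrite -mulrDl -hornerD -rmorphD !evE // rmorphD hornerD mulrDl.
Qed.

Lemma evM z z' : laurent z -> laurent z' -> ev q (z * z') = ev q z * ev q z'.
Proof.
move=> hz hz'; have [p [p' [n [-> ->]]]] := laurent_pair hz hz'.
by rewrite mulrACA -invfM -exprD -hornerM -rmorphM !evE // rmorphM hornerM exprD invfM mulrACA.
Qed.

Lemma ev_int (m : int) : ev q m%:~R = m%:~R.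
Proof.
have -> : m%:~R = (map_poly intr m%:P).[vv] / vv ^+ 0 :> Qv.
  by rewrite expr0 divr1 map_polyC hornerC.
by rewrite evE // expr0 divr1 map_polyC hornerC.
Qed.

Lemma ev0 : ev q 0 = 0. Proof. exact: (ev_int 0). Qed.
Lemma ev1 : ev q 1 = 1. Proof. exact: (ev_int 1). Qed.

Lemma evX (n : int) : ev q (vv ^ n) = q ^ n.
Proof.
case: n => n.
  have -> : vv ^ n = (map_poly intr 'X^n).[vv] / vv ^+ 0 :> Qv.
    by rewrite map_polyXn hornerXn expr0 divr1.
  by rewrite evE // expr0 divr1 map_polyXn hornerXn.
have -> : vv ^ (Negz n) = (map_poly intr 1).[vv] / vv ^+ n.+1 :> Qv.
  by rewrite rmorph1 hornerC div1r.
by rewrite evE // rmorph1 hornerC div1r.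
Qed.

End Laurent.

Lemma int_updown (P : int -> Prop) : P 0 -> (forall a, P a -> P (a + 1)) ->
  (forall a, P (a + 1) -> P a) -> forall a, P a.
Proof.
move=> P0 up down; elim/int_ind => // n; first by rewrite intS addrC; apply: up.
by move=> Pn; apply: down; rewrite intS opprD addrAC addNr add0r.
Qed.

(** * Quantum integers and binomials *)

Section QuantumIntegers.

Lemma vvD (m n : int) : vv ^ (m + n) = vv ^ m * vv ^ n.
Proof. by rewrite expfzDr // vv_neq0. Qed.

Lemma vv_subV_neq0 (n : nat) : vv ^+ n.+1 - vv ^- n.+1 != 0.
Proof.
rewrite subr_eq0; apply/eqP => e.
have : tofrac ('X^(n.+1) * 'X^(n.+1) : {poly rat}) = tofrac 1.
  rewrite rmorphM rmorph1 rmorphXn; change (vv ^+ n.+1 * vv ^+ n.+1 = 1).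
  by rewrite [X in X * _]e mulVf // expf_neq0 // vv_neq0.
move/eqP; rewrite tofrac_eq -exprD => /eqP/(congr1 (fun p : {poly rat} => size p)).
by rewrite size_polyXn size_poly1.
Qed.

Lemma qint_neq0 (n : nat) : qint n.+1 != 0.
Proof.
apply: mulf_neq0; first exact: vv_subV_neq0.
by apply: invr_neq0; apply: (vv_subV_neq0 0).
Qed.

Lemma qfactS n : qfact n.+1 = qfact n * qint n.+1.
Proof. by rewrite /qfact big_nat_recr. Qed.

Lemma qfact0 : qfact 0 = 1. Proof. by rewrite /qfact big_geq. Qed.

Lemma qint0 : qint 0 = 0. Proof. by rewrite /qint subrr mul0r. Qed.

(** Insert [vv ^ (b - a)], which occurs on the right with both signs. Both
   [qbin_pascal] and [klin_split] rest on this identity. *)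
Lemma qintD_mul (a b : int) : qint (a + b) = vv ^ b * qint a + vv ^ (- a) * qint b.
Proof. by rewrite /qint opprD !vvD; ring. Qed.

Lemma qbin0 a : qbin a 0%N = 1.
Proof. by rewrite /qbin qfact0 big_geq // divr1. Qed.

Lemma qbinSr (a : int) (r : nat) : qbin a r.+1 = qbin a r * (qint (a - r%:Z) / qint r.+1).
Proof. by rewrite /qbin big_nat_recr //= qfactS invfM mulrACA. Qed.

Lemma qbinSl (a : int) (r : nat) : qbin (a + 1) r.+1 = qint (a + 1) / qint r.+1 * qbin a r.
Proof.
elim: r => [|r IH]; first by rewrite qbinSr !qbin0 subr0 mulr1 mul1r.
have ar : a + 1 - r.+1%:Z = a - r%:Z by rewrite intS; ring.
rewrite qbinSr IH ar [qbin a r.+1]qbinSr.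
move: (qint r.+1)^-1 (qint r.+2)^-1 (qint (a - r%:Z)) (qint (a + 1)) (qbin a r) => c d x y z.
ring.
Qed.

(** The two binomials on the right share all factors but one with the left-hand
   side; the remaining factors satisfy [qintD_mul] for [(a - r) + (r + 1)]. *)
Lemma qbin_pascal (a : int) (r : nat) :
  qbin (a + 1) r.+1 = vv ^ r.+1%:Z * qbin a r.+1 + vv ^ (r%:Z - a) * qbin a r.
Proof.
rewrite qbinSl qbinSr.
have -> : a + 1 = (a - r%:Z) + r.+1%:Z by rewrite intS; ring.
rewrite qintD_mul opprB; have := qint_neq0 r.
move: (qint r.+1) (qint _) (qbin a r) (vv ^ _) (vv ^ _) => d x y z t d0.
by rewrite mulrDl mulfK // mulrDl; ring.
Qed.

Lemma qbin0S (r : nat) : qbin 0 r.+1 = 0.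
Proof. by rewrite /qbin big_nat_recl // subr0 qint0 !mul0r. Qed.

(** Pascal's rule has unit coefficients in front of both binomials of degree
   [r + 1], so integrality spreads from [a = 0] to all integers. *)
Lemma laurent_qbin (a : int) (r : nat) : laurent (qbin a r).
Proof.
elim: r a => [|r IH] a; first by rewrite qbin0; apply: laurent1.
elim/int_updown: a => [|a ha|a].
- by rewrite qbin0S; apply: laurent0.
- by rewrite qbin_pascal; apply: laurentD; apply: laurentM => //; apply: laurentX.
move=> ha; have -> : qbin a r.+1 =
    vv ^ (- r.+1%:Z) * (qbin (a + 1) r.+1 - vv ^ (r%:Z - a) * qbin a r).
  by rewrite qbin_pascal addrK mulrA -vvD addNr mul1r.
apply: laurentM; first exact: laurentX.
by apply: laurentD => //; apply: laurentN; apply: laurentM => //; apply: laurentX.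
Qed.

End QuantumIntegers.

(** * Commutation relations in the quantum group *)

Section QuantumAlgebra.
Variable RS : rootSystem.
Implicit Types (a b : simple RS) (X Y : UQ RS) (c d : int).

Lemma UQ_scaleAl (z : Qv) X Y : z *: (X * Y) = (z *: X) * Y.
Proof. exact: presalg_scaleAl. Qed.
Lemma UQ_scaleAr (z : Qv) X Y : z *: (X * Y) = X * (z *: Y).
Proof. exact: presalg_scaleAr. Qed.

Local Notation pc := (pcl (@qrel RS)).

Lemma pclM x y : pc (TMul x y) = (pc x : UQ RS) * pc y.
Proof. by rewrite [RHS]pmulE. Qed.
Lemma pclZ z x : pc (TScale z x) = z *: (pc x : UQ RS).
Proof. by rewrite [RHS]pscaleE. Qed.
Lemma pclB x y : pc (TAdd x (TOpp y)) = (pc x : UQ RS) - pc y.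
Proof. by rewrite [- _]poppE [RHS]paddE. Qed.
Lemma qrel_pcl x y : qrel x y -> pc x = pc y.
Proof. by move=> h; apply/pcl_eq/cong_rel. Qed.

Lemma qk_kk a b : qk a * qk b = qk b * qk a.
Proof. by have := qrel_pcl (qrel_kk a b); rewrite !pclM. Qed.
Lemma qk_ki a : qk a * qki a = 1.
Proof. by have := qrel_pcl (qrel_kki a); rewrite !pclM. Qed.
Lemma qki_k a : qki a * qk a = 1.
Proof. by have := qrel_pcl (qrel_kik a); rewrite !pclM. Qed.

(** Both conditions are kept since elements of U^0 involve [k] and its inverse. *)
Definition qwt a (m : int) X :=
  qk a * X = vv ^ m *: (X * qk a) /\ qki a * X = vv ^ (- m) *: (X * qki a).

Lemma qwt_conj a (m : int) X : qk a * X * qki a = vv ^ m *: X -> qwt a m X.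
Proof.
move=> h; have kX : qk a * X = vv ^ m *: (X * qk a).
  by rewrite UQ_scaleAl -h -mulrA qki_k mulr1.
split=> //; rewrite -[RHS]mul1r -(qki_k a) -mulrA -UQ_scaleAr [qk a * _]mulrA kX.
by rewrite -UQ_scaleAl scalerA -vvD addNr scale1r -!mulrA qk_ki mulr1.
Qed.

Lemma qwt_e a b : qwt a (pairing (sroot b) a) (qe b).
Proof. by apply: qwt_conj; have := qrel_pcl (qrel_ke a b); rewrite !pclM pclZ. Qed.
Lemma qwt_f a b : qwt a (- pairing (sroot b) a) (qf b).
Proof. by apply: qwt_conj; have := qrel_pcl (qrel_kf a b); rewrite !pclM pclZ. Qed.

Lemma qwtM a (m m' : int) X Y : qwt a m X -> qwt a m' Y -> qwt a (m + m') (X * Y).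
Proof.
move=> [h1 h2] [h3 h4]; split; rewrite mulrA.
  by rewrite h1 -UQ_scaleAl -mulrA h3 -UQ_scaleAr scalerA -vvD !mulrA.
by rewrite h2 -UQ_scaleAl -mulrA h4 -UQ_scaleAr scalerA -vvD -opprD !mulrA.
Qed.

Lemma qwt1 a : qwt a 0 1.
Proof. by split; rewrite mulr1 ?oppr0 expr0z scale1r mul1r. Qed.

Lemma qwtX a (m : int) X n : qwt a m X -> qwt a (m *+ n) (X ^+ n).
Proof.
move=> hX; elim: n => [|n IH]; first by rewrite mulr0n expr0; apply: qwt1.
by rewrite mulrSr exprSr; apply: qwtM.
Qed.

Lemma qwtZ a (m : int) z X : qwt a m X -> qwt a m (z *: X).
Proof.
by move=> [h1 h2]; split; rewrite -UQ_scaleAr -UQ_scaleAl ?h1 ?h2 !scalerA mulrC.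
Qed.

Lemma qwtB a (m : int) X Y : qwt a m X -> qwt a m Y -> qwt a m (X - Y).
Proof.
move=> [h1 h2] [h3 h4].
by split; rewrite mulrBr mulrBl scalerBr ?h1 ?h2 ?h3 ?h4.
Qed.

Lemma qwt_edp a b n : qwt a (pairing (sroot b) a *+ n) (qe_dp b n).
Proof. by apply/qwtZ/qwtX/qwt_e. Qed.

Lemma qwt_fdp a b n : qwt a (- (pairing (sroot b) a *+ n)) (qf_dp b n).
Proof. by rewrite -mulNrn; apply/qwtZ/qwtX/qwt_f. Qed.

Lemma qk_k_ki a b : qk a * qki b = qki b * qk a.
Proof.
rewrite -[LHS]mul1r -(qki_k b) -mulrA [qk b * _]mulrA -qk_kk -mulrA qk_ki.
by rewrite mulr1.
Qed.

Lemma qki_kiki a b : qki a * qki b = qki b * qki a.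
Proof.
rewrite -[LHS]mul1r -(qki_k b) -mulrA [qk b * _]mulrA qk_k_ki -mulrA qk_ki.
by rewrite mulr1.
Qed.

Lemma qwt_k a b : qwt a 0 (qk b).
Proof. by split; rewrite ?oppr0 expr0z scale1r; [apply: qk_kk | rewrite qk_k_ki]. Qed.
Lemma qwt_ki a b : qwt a 0 (qki b).
Proof. by split; rewrite ?oppr0 expr0z scale1r; [apply: qk_k_ki | apply: qki_kiki]. Qed.

(** [klin] and [kbin] are the elements usually written [K; c] and [K; c, r]:
   [k; 1] and [k; r] with [k] replaced by [vv ^ c k]. They are locked so that
   rewriting with the laws of scaling does not look inside them. *)
Definition klin a c : UQ RS :=
  locked ((vv - vv^-1)^-1 *: (vv ^ c *: qk a - vv ^ (- c) *: qki a)).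

Lemma klinE a c :
  klin a c = (vv - vv^-1)^-1 *: (vv ^ c *: qk a - vv ^ (- c) *: qki a).
Proof. by rewrite /klin -lock. Qed.

Lemma qwt_klin a b c : qwt a 0 (klin b c).
Proof. by rewrite klinE; apply/qwtZ/qwtB; apply: qwtZ; [apply: qwt_k | apply: qwt_ki]. Qed.

Definition kbin a c (r : nat) : UQ RS := locked (
  \prod_(0 <= i < r) ((qint i.+1)^-1 *: klin a (c - i%:Z))).

Lemma klin_comm a (m : int) c X : qwt a m X -> klin a c * X = X * klin a (c + m).
Proof.
move=> [h1 h2]; rewrite !klinE -UQ_scaleAl -UQ_scaleAr mulrBl mulrBr; congr (_ *: _).
rewrite -!UQ_scaleAl -!UQ_scaleAr h1 h2 !scalerA opprD -!vvD.
by [].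
Qed.

Lemma kbin0 a c : kbin a c 0 = 1.
Proof. by rewrite /kbin -!lock big_geq. Qed.

Lemma kbinSr a c r : kbin a c r.+1 = (qint r.+1)^-1 *: (kbin a c r * klin a (c - r%:Z)).
Proof. by rewrite /kbin -!lock big_nat_recr //= UQ_scaleAr. Qed.

Lemma qwt_kbin a b c r : qwt a 0 (kbin b c r).
Proof.
elim: r => [|r IH]; first by rewrite kbin0; apply: qwt1.
by rewrite kbinSr -[0]addr0; apply/qwtZ/qwtM => //; apply: qwt_klin.
Qed.

Lemma klin_kbin a c d r : klin a c * kbin a d r = kbin a d r * klin a c.
Proof. by rewrite (klin_comm _ (qwt_kbin _ _ _ _)) addr0. Qed.

Lemma kbin_comm a (m : int) c r X : qwt a m X -> kbin a c r * X = X * kbin a (c + m) r.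
Proof.
move=> hX; elim: r => [|r IH]; first by rewrite !kbin0 mulr1 mul1r.
rewrite !kbinSr -UQ_scaleAl -UQ_scaleAr -mulrA (klin_comm _ hX) mulrA IH.
by rewrite mulrA addrAC.
Qed.

Lemma kbinSl a c r : kbin a (c + 1) r.+1 = (qint r.+1)^-1 *: (klin a (c + 1) * kbin a c r).
Proof.
elim: r => [|r IH]; first by rewrite kbinSr !kbin0 subr0 mulr1 mul1r.
rewrite kbinSr IH [kbin a c r.+1]kbinSr -UQ_scaleAl -UQ_scaleAr -mulrA.
by have -> : c + 1 - r.+1%:Z = c - r%:Z by rewrite intS; ring.
Qed.

(** [klin a c] is the same combination of [vv ^ c k] and [vv ^ (- c) k^-1] for all
   [c]: a linear relation holds once the coefficients of [k] and of [k^-1] agree. *)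
Lemma klin_rel a (x y z : Qv) c d e :
  x * vv ^ c + y * vv ^ d = z * vv ^ e ->
  x * vv ^ (- c) + y * vv ^ (- d) = z * vv ^ (- e) ->
  x *: klin a c + y *: klin a d = z *: klin a e.
Proof.
move=> h1 h2; rewrite !klinE !scalerBr !scalerA ![_ * (vv - _)^-1]mulrC -!mulrA.
rewrite -h1 -h2 !mulrDr !scalerDl opprD addrACA.
by [].
Qed.

(** The only identity between quantum integers behind the commutation formula. *)
Lemma klin_split a (y p r : int) :
  qint p *: klin a (y - r) + qint r *: klin a (y + p) = qint (p + r) *: klin a y.
Proof.
have e := vvD; apply: klin_rel; rewrite ?opprD ?opprK !e.
  by rewrite [p + r]addrC qintD_mul; ring.
by rewrite qintD_mul; ring.
Qed.

Lemma klin_shift a c d :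
  klin a (c + d) = vv ^ d *: klin a c + (vv ^ (- c) * qint d) *: qki a.
Proof.
rewrite !klinE /qint !scalerBr !scalerA opprD !vvD -addrA; congr (_ + _).
  by congr (_ *: _); ring.
by rewrite -!scaleNr -scalerDl; congr (_ *: _); ring.
Qed.

Lemma kbin_pascal a c r : kbin a (c + 1) r.+1 =
  vv ^ r.+1%:Z *: kbin a c r.+1 + vv ^ (r%:Z - c) *: (qki a * kbin a c r).
Proof.
have e : c + 1 = (c - r%:Z) + r.+1%:Z by rewrite intS; ring.
rewrite kbinSl kbinSr [in LHS]e klin_shift mulrDl scalerDr -!UQ_scaleAl klin_kbin.
rewrite opprB !scalerA; congr (_ *: _ + _ *: _); first exact: mulrC.
by rewrite mulrCA mulVf ?mulr1 // qint_neq0.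
Qed.

(** After cancelling the common factor [kbin a c r] this is [klin_split]. *)
Lemma kbin_split a c r (p : int) :
  qint p *: kbin a c r.+1 + klin a (c + 1 + p) * kbin a c r
    = qint (p + r.+1%:Z) *: kbin a (c + 1) r.+1.
Proof.
apply: (scalerI (qint_neq0 r)); rewrite scalerDr !scalerA.
rewrite mulrC kbinSr kbinSl !klin_kbin scalerA mulfK ?qint_neq0 //.
rewrite [in RHS]mulrC scalerA mulfK ?qint_neq0 //.
rewrite !UQ_scaleAr -mulrDr; congr (_ * _).
rewrite -klin_split; congr (_ *: klin _ _ + _).
by rewrite intS; ring.
Qed.

Lemma qk_binE a r : qk_bin a r = kbin a 0 r.
Proof.
rewrite /qk_bin /kbin -!lock big_add1; apply: eq_bigr => i _.
rewrite !klinE /qint scalerA; congr (_ *: (_ *: _ - _ *: _)).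
- by rewrite invfM invrK mulfK //; apply: (vv_subV_neq0 0).
- by congr (vv ^ _); rewrite intS; ring.
by congr (vv ^ _); rewrite intS; ring.
Qed.

Lemma qe_dp0 a : qe_dp a 0 = 1. Proof. by rewrite /qe_dp qfact0 invr1 scale1r. Qed.
Lemma qf_dp0 a : qf_dp a 0 = 1. Proof. by rewrite /qf_dp qfact0 invr1 scale1r. Qed.

Lemma qe_dpS a n : qe a * qe_dp a n = qint n.+1 *: qe_dp a n.+1.
Proof.
by rewrite /qe_dp -UQ_scaleAr -exprS scalerA qfactS invfM mulrCA mulfV ?mulr1 ?qint_neq0.
Qed.

Lemma qe_qf_comm a b (m n : nat) : a != b -> qe_dp a m * qf_dp b n = qf_dp b n * qe_dp a m.
Proof.
move=> ab; rewrite /qe_dp /qf_dp -!UQ_scaleAl -!UQ_scaleAr !scalerA mulrC; congr (_ *: _).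
apply: (commrX n); apply: commr_sym; apply: (commrX m); apply: commr_sym.
have := qrel_pcl (qrel_ef ab); rewrite pclB !pclM => /eqP.
by rewrite subr_eq0 => /eqP.
Qed.

Lemma sroot_pairing a : pairing (sroot a) a = 2.
Proof.
rewrite /pairing (rs_coroot2 (rs_base_roots (ssvalP a))).
exact: (@floorK _ 2).
Qed.

(** Passing one more [f] creates [klin a 0] next to [f ^ n]; by [klin_split] it
   merges with the term already present. *)
Lemma qe_qfX a n :
  qe a * qf a ^+ n.+1 = qf a ^+ n.+1 * qe a + qint n.+1 *: (qf a ^+ n * klin a (- n%:Z)).
Proof.
have ef : qe a * qf a = qf a * qe a + klin a 0.
  have := qrel_pcl (qrel_efk a); rewrite pclB !pclM pclZ pclB => /eqP.
  by rewrite subr_eq addrC => /eqP ->; rewrite !klinE oppr0 !scale1r.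
elim: n => [|n IH].
  by rewrite expr1 ef expr0 mul1r oppr0 /qint divff ?scale1r //; exact: (vv_subV_neq0 0).
rewrite [X in qe a * X]exprSr mulrA IH mulrDl -mulrA ef mulrDr mulrA -exprSr -addrA.
congr (_ + _); rewrite -UQ_scaleAl -mulrA (klin_comm _ (qwt_f a a)) sroot_pairing mulrA -exprSr.
rewrite !UQ_scaleAr -mulrDr; congr (_ * _).
have := klin_split a (- n.+1%:Z) n.+1%:Z 1; rewrite addNr addrC.
have -> : n.+1%:Z + 1 = n.+2%:Z by rewrite [n.+2%:Z]intS addrC.
have -> : - n.+1%:Z - 1 = - n%:Z - 2 by rewrite intS; ring.
by rewrite {1}/qint divff ?scale1r //; exact: (vv_subV_neq0 0).
Qed.

(** [f^(n - r)], understood as 0 for [r > n]; this convention makes the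
   commutation formulas below uniform in [r]. *)
Definition qf_sub a (n r : nat) : UQ RS := if (r <= n)%N then qf_dp a (n - r) else 0.

Lemma qe_qf_sub a n r :
  qe a * qf_sub a n r = qf_sub a n r * qe a + qf_sub a n r.+1 * klin a (r.+1%:Z - n%:Z).
Proof.
rewrite /qf_sub; case: ltngtP => [rn|rn|<-].
- have [s es] : exists s, (n - r)%N = s.+1 by exists (n - r).-1; rewrite prednK ?subn_gt0.
  have -> : (n - r.+1)%N = s by rewrite subnS es.
  have -> : r.+1%:Z - n%:Z = - s%:Z.
    by rewrite -(subnK (ltnW rn)) es PoszD !intS; ring.
  rewrite es /qf_dp -UQ_scaleAr -!UQ_scaleAl qe_qfX scalerDr; congr (_ + _).
  by rewrite scalerA qfactS invfM mulfVK ?qint_neq0.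
- by rewrite !mul0r mulr0 addr0.
by rewrite subnn qf_dp0 mul0r addr0 mul1r mulr1.
Qed.

(** Multiplying the formula for [m] by [e] on the left turns its term of index [r]
   into one of index [r] and one of index [r + 1] of the formula for [m + 1];
   [kbin_split] adds up the two contributions to each index. *)
Lemma qe_qf_dp a m n : qe_dp a m * qf_dp a n =
  \sum_(0 <= r < m.+1)
     qf_sub a n r * kbin a (r%:Z *+ 2 - m%:Z - n%:Z) r * qe_dp a (m - r).
Proof.
elim: m => [|m IH].
  by rewrite big_nat1 kbin0 qe_dp0 mulr1 mulr1 mul1r /qf_sub subn0.
apply: (scalerI (qint_neq0 m)); rewrite UQ_scaleAl -qe_dpS -mulrA IH mulr_sumr.
(* [U r] and [V r] are the two contributions to the index [r]; they vanish at
   the ends [m + 1] and [0] of the range respectively. *)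
pose U r := qint (m.+1 - r)%N%:Z *: (qf_sub a n r *
   kbin a (r%:Z *+ 2 - m%:Z - n%:Z - 2) r * qe_dp a (m.+1 - r)).
pose V r := if r is s.+1 then qf_sub a n r * (klin a (r%:Z - n%:Z) *
   kbin a (s%:Z *+ 2 - m%:Z - n%:Z) s) * qe_dp a (m - s) else 0.
transitivity (\sum_(0 <= r < m.+1) (U r + V r.+1)).
  apply: eq_big_nat => r /andP[_ rm].
  rewrite !mulrA qe_qf_sub mulrDl mulrDl -!mulrA; congr (_ + _); last first.
    by rewrite /V !mulrA.
  have := kbin_comm (r%:Z *+ 2 - m%:Z - n%:Z - 2) r (qwt_e a a).
  rewrite sroot_pairing subrK => h; rewrite [qe a * _]mulrA -h -!mulrA qe_dpS.
  by rewrite -2!UQ_scaleAr -subSn // /U !mulrA.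
rewrite big_split /=.
have -> : \sum_(0 <= r < m.+1) U r = \sum_(0 <= r < m.+2) U r.
  have U0 : U m.+1 = 0 by rewrite /U subnn qint0 scale0r.
  by rewrite [RHS]big_nat_recr //= U0 addr0.
have -> : \sum_(0 <= r < m.+1) V r.+1 = \sum_(0 <= r < m.+2) V r.
  by rewrite [RHS]big_nat_recl //= add0r.
rewrite -big_split scaler_sumr; apply: eq_big_nat => -[_|r /andP[_ rm]] /=.
  by rewrite addr0 /U !kbin0.
rewrite /U /V subSS UQ_scaleAl UQ_scaleAr -mulrDl -mulrDr UQ_scaleAl UQ_scaleAr.
congr (_ * _ * _).
have -> : r.+1%:Z *+ 2 - m%:Z - n%:Z - 2 = r%:Z *+ 2 - m%:Z - n%:Z by rewrite intS; ring.
have -> : r.+1%:Z *+ 2 - m.+1%:Z - n%:Z = r%:Z *+ 2 - m%:Z - n%:Z + 1.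
  by rewrite !intS; ring.
have := kbin_split a (r%:Z *+ 2 - m%:Z - n%:Z) r (m - r)%N.
have -> : (m - r)%N%:Z + r.+1%:Z = m.+1%:Z by rewrite -PoszD addnS subnK.
suff -> : r%:Z *+ 2 - m%:Z - n%:Z + 1 + (m - r)%N%:Z = r.+1%:Z - n%:Z by [].
by rewrite -subzn // intS; ring.
Qed.

End QuantumAlgebra.

(** * The integral form and its specialisation *)

Section IntegralForm.
Variable RS : rootSystem.
Implicit Types (a b : simple RS) (u : UQ RS).

Lemma zgen0 (G : set (UQ RS)) : zgen G 0.
Proof. by rewrite -(scale0r (1 : UQ RS)); apply: zgen_scale laurent0 (zgen_one _). Qed.

Lemma zgen_opp (G : set (UQ RS)) u : zgen G u -> zgen G (- u).
Proof. by move=> h; rewrite -scaleN1r; apply: zgen_scale => //; apply: (laurent_int (-1)). Qed.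

Lemma zgen_sub (G : set (UQ RS)) u u' : zgen G u -> zgen G u' -> zgen G (u - u').
Proof. by move=> h h'; apply: zgen_add => //; apply: zgen_opp. Qed.

Lemma zgen_sum (G : set (UQ RS)) (I : Type) (s : seq I) (F : I -> UQ RS) :
  (forall i, zgen G (F i)) -> zgen G (\sum_(i <- s) F i).
Proof.
move=> h; elim: s => [|i s IH]; first by rewrite big_nil; apply: zgen0.
by rewrite big_cons; apply: zgen_add.
Qed.

Lemma UZ_qf_sub a n r : zgen (@UZ_gens RS) (qf_sub a n r).
Proof. by rewrite /qf_sub; case: ifP => _; [apply: UZ_f | apply: zgen0]. Qed.

Lemma UZ_k a : zgen (@UZ_gens RS) (qk a).
Proof. by apply: zgen_in; exists a; apply: Or43. Qed.
Lemma UZ_ki a : zgen (@UZ_gens RS) (qki a).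
Proof. by apply: zgen_in; exists a; apply: Or44. Qed.

(** In the commutation formula for [e^(r) f^(r)] the last term is [kbin a 0 r] and
   all others contain a [kbin] of smaller degree, so induction on [r] gives
   [c = 0]; Pascal's rule, used in both directions, gives the other [c]. *)
Lemma UZ_kbin a c r : zgen (@UZ_gens RS) (kbin a c r).
Proof.
elim/ltn_ind: r c => -[|r] IH c; first by rewrite kbin0; apply: zgen_one.
elim/int_updown: c => [|c hc|c].
- have := qe_qf_dp a r.+1 r.+1; rewrite big_nat_recr //=.
  have -> : qf_sub a r.+1 r.+1 = 1 by rewrite /qf_sub leqnn subnn qf_dp0.
  rewrite subnn qe_dp0.
  rewrite mul1r mulr1 mulr2n addrK subrr addrC => /(canLR (addrK _)) <-.
  apply: zgen_sub; first by apply: zgen_mul; [apply: UZ_e | apply: UZ_f].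
  rewrite big_seq; elim/big_ind: _ => [|x y|s]; first exact: zgen0.
    exact: zgen_add.
  rewrite mem_index_iota => /andP[_ sr].
  apply: zgen_mul (UZ_e _ _); apply: zgen_mul (UZ_qf_sub _ _ _) _; exact: IH.
- rewrite kbin_pascal; apply: zgen_add; apply: zgen_scale; try exact: laurentX; first by [].
  by apply: zgen_mul (UZ_ki _) _; apply: IH.
move=> hc; have -> : kbin a c r.+1 = vv ^ (- r.+1%:Z) *:
    (kbin a (c + 1) r.+1 - vv ^ (r%:Z - c) *: (qki a * kbin a c r)).
  by rewrite kbin_pascal addrK scalerA -vvD addNr expr0z scale1r.
apply: zgen_scale; first exact: laurentX.
apply: zgen_sub => //; apply: zgen_scale; first exact: laurentX.
by apply: zgen_mul (UZ_ki _) _; apply: IH.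
Qed.

Variables (K : fieldType) (q : K).
Hypothesis q_neq0 : q != 0.
Local Notation Uq := (Uq RS q).
Local Notation isUZ := (zgen (@UZ_gens RS)).

(** A total function, so that elements need not carry their proof of integrality;
   it is multiplicative and additive on the integral form only. *)
Definition spec u : Uq := if pselect (isUZ u) is left h then pure q (zelt h) 1 else 0.

Lemma specE (u : zalg (@UZ_gens RS)) : spec (zval u) = pure q u 1.
Proof.
rewrite /spec; case: pselect => [h|]; last by case; apply: zvalP.
by congr pure; apply: val_inj.
Qed.

Lemma spec_zelt u (h : isUZ u) : spec u = pure q (zelt h) 1.
Proof. by rewrite -specE. Qed.

Lemma Uq_scaleAl (c : K) (x y : Uq) : c *: (x * y) = (c *: x) * y.
Proof. exact: zalgK_scaleAl. Qed.
Lemma Uq_scaleAr (c : K) (x y : Uq) : c *: (x * y) = x * (c *: y).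
Proof. exact: zalgK_scaleAr. Qed.

Section Pure.
Variable G : set (UQ RS).
Implicit Types x y : zalg G.

Lemma pureD x y (c : K) : pure q (x + y) c = pure q x c + pure q y c.
Proof. by rewrite [RHS]taddE; apply/tcl_eq/tcong_Dl. Qed.
Lemma pureM x y (c d : K) : pure q x c * pure q y d = pure q (x * y) (c * d).
Proof. by rewrite [LHS]tmulE. Qed.
Lemma pureZ x (c : K) : pure q x c = c *: pure q x 1.
Proof. by rewrite [RHS]tscaleE /sscale /tmap /= mulr1. Qed.
Lemma pure_bal z x y (c : K) : laurent z -> zval y = z *: zval x ->
  pure q y c = pure q x (ev q z * c).
Proof. by move=> hz e; apply/tcl_eq/tcong_bal. Qed.
Lemma tcl_sum (s : seq (zalg G * K)) : tcl q s = \sum_(y <- s) y.2 *: pure q y.1 1.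
Proof.
elim: s => [|y s IH]; first by rewrite big_nil.
by rewrite big_cons -IH -pureZ [RHS]taddE; case: y.
Qed.
End Pure.

Lemma specD u u' : isUZ u -> isUZ u' -> spec (u + u') = spec u + spec u'.
Proof. by move=> h h'; rewrite (spec_zelt h) (spec_zelt h') -[RHS]pureD -specE. Qed.

Lemma specM u u' : isUZ u -> isUZ u' -> spec (u * u') = spec u * spec u'.
Proof. by move=> h h'; rewrite (spec_zelt h) (spec_zelt h') [RHS]pureM mul1r -specE. Qed.

Lemma specZ z u : laurent z -> isUZ u -> spec (z *: u) = ev q z *: spec u.
Proof.
move=> hz h; rewrite (spec_zelt h) (spec_zelt (zgen_scale hz h)).
by rewrite (@pure_bal _ z (zelt h)) // mulr1 pureZ.
Qed.

Lemma spec1 : spec 1 = 1.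
Proof. by rewrite -[1 : UQ RS]/(zval (1 : zalg (@UZ_gens RS))) specE. Qed.

Lemma spec0 : spec 0 = 0.
Proof.
by rewrite -(scale0r (1 : UQ RS)) (specZ laurent0 (zgen_one _)) (ev0 q_neq0) scale0r.
Qed.

Lemma spec_sum (I : Type) (s : seq I) (F : I -> UQ RS) :
  (forall i, isUZ (F i)) -> spec (\sum_(i <- s) F i) = \sum_(i <- s) spec (F i).
Proof.
move=> h; elim: s => [|i s IH]; first by rewrite !big_nil spec0.
by rewrite !big_cons specD ?IH //; apply: zgen_sum.
Qed.

(** [U0_incl] is defined on a chosen representative; this is its value on an
   arbitrary one. *)
Definition spec0_sum (s : seq (zalg (@U0Z_gens RS) * K)) : Uq :=
  \sum_(y <- s) y.2 *: spec (zval y.1).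

Lemma UZ_U0 (x : zalg (@U0Z_gens RS)) : isUZ (zval x).
Proof. exact: U0Z_sub (zvalP x). Qed.

Lemma spec0_sum_cong s t : tcong q s t -> spec0_sum s = spec0_sum t.
Proof.
rewrite /spec0_sum.
elim=> {s t} [s|s t _ ->|s t r _ -> _ ->|s s' t t' _ + _|s t|c|u u' c|u c c'|z u w c hz hw] //=.
- by rewrite !big_cat /= => -> ->.
- by rewrite !big_cat /= addrC.
- by rewrite big_seq1 big_nil /= spec0 scaler0.
- by rewrite !big_cons !big_nil /= !addr0 specD ?scalerDr //; apply: UZ_U0.
- by rewrite !big_cons !big_nil /= !addr0 scalerDl.
by rewrite !big_seq1 /= hw specZ ?scalerA 1?mulrC //; apply: UZ_U0.
Qed.

Lemma U0_incl_tcl s : U0_incl (tcl q s) = spec0_sum s.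
Proof.
rewrite -(spec0_sum_cong (repr_tcong q s)) /U0_incl /zalgK_incl tcl_sum big_map.
by apply: eq_bigr => y _ /=; rewrite -spec_zelt.
Qed.

Lemma U0_incl_pure x c : U0_incl (pure q x c) = c *: spec (zval x).
Proof. by rewrite U0_incl_tcl /spec0_sum big_seq1. Qed.

Lemma U0_inclD H H' : U0_incl (H + H') = U0_incl H + U0_incl H' :> Uq.
Proof.
elim/tclW: H => s; elim/tclW: H' => t; rewrite [X in U0_incl X]taddE !U0_incl_tcl.
exact: big_cat.
Qed.

Lemma U0_inclZ c H : U0_incl (c *: H) = c *: U0_incl H :> Uq.
Proof.
elim/tclW: H => s; rewrite [X in U0_incl X]tscaleE !U0_incl_tcl.
by rewrite /spec0_sum big_map scaler_sumr; apply: eq_bigr => y _; rewrite scalerA.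
Qed.

Lemma U0_inclM H H' : U0_incl (H * H') = U0_incl H * U0_incl H' :> Uq.
Proof.
elim/tclW: H => s; elim/tclW: H' => t; rewrite [X in U0_incl X]tmulE !U0_incl_tcl.
rewrite /spec0_sum; elim: s => [|x s IH]; first by rewrite !big_nil mul0r.
rewrite smul_consl big_cat big_cons mulrDl -IH /=; congr (_ + _).
rewrite big_map mulr_sumr; apply: eq_bigr => y _ /=.
by rewrite specM -?Uq_scaleAl -?Uq_scaleAr ?scalerA //; apply: UZ_U0.
Qed.

Lemma U0_incl1 : U0_incl 1 = 1 :> Uq.
Proof. by rewrite U0_incl_pure scale1r -[zval 1]/(1 : UQ RS) spec1. Qed.

Lemma Ue_spec a n : Ue q a n = spec (qe_dp a n).
Proof. by rewrite (spec_zelt (UZ_e a n)). Qed.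
Lemma Uf_spec a n : Uf q a n = spec (qf_dp a n).
Proof. by rewrite (spec_zelt (UZ_f a n)). Qed.

End IntegralForm.

(** * Weight vectors *)

Section WeightVectors.
Variables (RS : rootSystem) (K : fieldType) (q : K).
Hypothesis q_neq0 : q != 0.
Variable L : lmodType (Uq RS q).
Local Notation isUZ := (zgen (@UZ_gens RS)).
Implicit Types (a b : simple RS) (mu : weight RS) (x y : resK L) (u : UQ RS) (w : Uq RS q).

Lemma UactD w w' x : Uact (w + w') x = Uact w x + Uact w' x.
Proof. exact: (scalerDl (x : L) w w'). Qed.
Lemma UactM w w' x : Uact (w * w') x = Uact w (Uact w' x).
Proof. by rewrite /Uact [RHS]scalerA. Qed.
Lemma Uact1 x : Uact 1 x = x.
Proof. exact: (scale1r (x : L)). Qed.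
Lemma UactZ (c : K) w x : Uact (c *: w) x = c *: Uact w x.
Proof. by rewrite [RHS]scalerA -Uq_scaleAl mul1r. Qed.
Lemma Uact_sum (I : Type) (s : seq I) (F : I -> Uq RS q) x :
  Uact (\sum_(i <- s) F i) x = \sum_(i <- s) Uact (F i) x.
Proof. exact: (scaler_suml (x : L)). Qed.

Fact Uact_linear w : linear (Uact w : resK L -> resK L).
Proof.
move=> c x y; rewrite {1}/Uact scalerDr; congr (_ + _).
by rewrite -UactZ [in RHS]/Uact scalerA -Uq_scaleAr mulr1.
Qed.
HB.instance Definition _ w :=
  GRing.isLinear.Build K (resK L) (resK L) _ (Uact w) (Uact_linear w).

Definition act u x : resK L := Uact (spec q u) x.

Lemma actM u u' x : isUZ u -> isUZ u' -> act (u * u') x = act u (act u' x).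
Proof. by move=> h h'; rewrite /act specM // UactM. Qed.
Lemma actD u u' x : isUZ u -> isUZ u' -> act (u + u') x = act u x + act u' x.
Proof. by move=> h h'; rewrite /act specD // UactD. Qed.
Lemma actZ z u x : laurent z -> isUZ u -> act (z *: u) x = ev q z *: act u x.
Proof. by move=> h h'; rewrite /act specZ // UactZ. Qed.
Lemma act1 x : act 1 x = x.
Proof. by rewrite /act spec1 Uact1. Qed.
Lemma act_scale u c x : act u (c *: x) = c *: act u x.
Proof. exact: linearZ. Qed.

(** The weight condition tested on generators of U^0 only. Unlike [wtspace] it
   does not involve the choice hidden in [chi]; both agree by [wtvecP]. *)
Definition wtvec mu x : Prop := forall a,
  [/\ act (qk a) x = q ^ pairing mu a *: x,
      act (qki a) x = q ^ (- pairing mu a) *: x &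
      forall r : nat, act (kbin a 0 r) x = ev q (qbin (pairing mu a) r) *: x].

(** Both sides obey Pascal's rule in [c], and they agree for [c = 0]. *)
Lemma wtvec_kbin mu x a c (r : nat) : wtvec mu x ->
  act (kbin a c r) x = ev q (qbin (pairing mu a + c) r) *: x.
Proof.
move=> /(_ a)[_ hki hbin].
elim: r c => [|r IH] c.
  by rewrite kbin0 act1 qbin0 ev1 // scale1r.
have pas c0 : act (kbin a (c0 + 1) r.+1) x = q ^ r.+1%:Z *: act (kbin a c0 r.+1) x +
    ev q (vv ^ (r%:Z - (pairing mu a + c0)) * qbin (pairing mu a + c0) r) *: x.
  have UZkk := zgen_mul (UZ_ki a) (UZ_kbin a c0 r).
  have UZk := UZ_kbin a c0 r.+1.
  rewrite kbin_pascal (actD _ (zgen_scale (laurentX _) UZk) (zgen_scale (laurentX _) UZkk)).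
  rewrite !(actZ _ (laurentX _)) ?evX //.
  rewrite actM; [|exact: UZ_ki|exact: UZ_kbin].
  rewrite IH act_scale hki !scalerA (evM q_neq0 (laurentX _) (laurent_qbin _ _)) ?evX //.
  congr (_ + _ *: _); rewrite mulrAC; congr (_ * _).
  by rewrite -expfzDr //; congr (q ^ _); ring.
have pasq c0 : ev q (qbin (pairing mu a + (c0 + 1)) r.+1) =
    q ^ r.+1%:Z * ev q (qbin (pairing mu a + c0) r.+1) +
    ev q (vv ^ (r%:Z - (pairing mu a + c0)) * qbin (pairing mu a + c0) r).
  have lb n := laurentM (laurentX n) (laurent_qbin _ _).
  rewrite addrA qbin_pascal (evD q_neq0 (lb _ _ _) (lb _ _ _)); congr (_ + _).
  by rewrite (evM q_neq0 (laurentX _) (laurent_qbin _ _)) evX.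
elim/int_updown: c => [|c hc|c].
- by rewrite addr0; apply: hbin.
- by rewrite pas hc pasq scalerA scalerDl.
rewrite pas pasq scalerDl => /addIr; rewrite -scalerA; apply: scalerI.
by rewrite expfz_neq0.
Qed.

(** Moving [kbin a 0 r] past [u] changes it to [kbin a c r], where [c] is the
   difference of the weights, and [wtvec_kbin] turns this shift of the element
   into a shift of the weight. *)
Lemma wtvec_shift mu nu x u : isUZ u ->
  (forall a, qwt a (pairing nu a - pairing mu a) u) ->
  wtvec mu x -> wtvec nu (act u x).
Proof.
move=> hu hw hx a; have [hk hki _] := hx a; have [h1 h2] := hw a.
have UZk := UZ_k a; have UZi := UZ_ki a; split.
- rewrite -actM // h1 (actZ _ (laurentX _) (zgen_mul hu UZk)).
  by rewrite evX // actM // hk act_scale scalerA -expfzDr // subrK.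
- rewrite -actM // h2 (actZ _ (laurentX _) (zgen_mul hu UZi)).
  rewrite evX // actM // hki act_scale scalerA -expfzDr //.
  by rewrite opprB addrAC subrr add0r.
move=> r; rewrite -actM ?(kbin_comm _ _ (hw a)); [|exact: UZ_kbin|by []].
rewrite actM //; last exact: UZ_kbin.
by rewrite (wtvec_kbin _ _ _ hx) act_scale add0r addrC subrK.
Qed.

Lemma U0_pure_act (v : zalg (@U0Z_gens RS)) x :
  Uact (U0_incl (pure q v 1)) x = act (zval v) x.
Proof. by rewrite U0_incl_pure // scale1r. Qed.

(** If there were no character of weight [mu], then [chi mu] would be 0 and the
   unit of U^0 would kill [x]. *)
Lemma wtspace_wtvec mu x : wtspace mu x -> wtvec mu x.
Proof.
move=> hx; have [->|x0] := eqVneq x 0.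
  move=> a; have a0 u : act u 0 = 0 by apply: linear0.
  by split=> [||r]; rewrite a0 scaler0.
have [_ _ hchi] : is_chi mu (chi (q := q) mu).
  apply: xgetPex; apply: contrapT => no_chi; case/eqP: x0.
  have := hx 1; rewrite U0_incl1 // Uact1 => ->.
  rewrite /chi xgetPN ?scale0r // => c hc; apply: no_chi; by exists c.
have act_gen u : @U0Z_gens RS u -> exists2 v : zalg (@U0Z_gens RS), zval v = u &
    act u x = chi mu (pure q v 1) *: x.
  move=> hu; have hu' := zgen_in hu; exists (zelt hu') => //.
  by rewrite -(hx (pure q (zelt hu') 1)) U0_pure_act.
move=> a; split=> [||r].
- have [] := act_gen (qk a); first by split; [apply: UZ_k | exists a; apply: Or31].
  by move=> v ev ->; have [/(_ ev) -> _ _] := hchi a v.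
- have [] := act_gen (qki a); first by split; [apply: UZ_ki | exists a; apply: Or32].
  by move=> v ev ->; have [_ /(_ ev) -> _] := hchi a v.
have [] := act_gen (kbin a 0 r).
  by split; [apply: UZ_kbin | exists a; apply: Or33; exists r; rewrite qk_binE].
by move=> v; rewrite -qk_binE => ev ->; have [_ _ /(_ r ev) ->] := hchi a v.
Qed.

Lemma is_chi_act mu x (ch : Uq0 RS q -> K) : is_chi mu ch -> wtvec mu x ->
  forall H, Uact (U0_incl H) x = ch H *: x.
Proof.
move=> [chlin [ch1 chM] chgen] hx H.
have chD H1 H2 : ch (H1 + H2) = ch H1 + ch H2 by have := chlin 1 H1 H2; rewrite scale1r mul1r.
have ch0 : ch 0 = 0 by apply: (addrI (ch 0)); rewrite -chD !addr0.
have chZ c H1 : ch (c *: H1) = c * ch H1 by have := chlin c H1 0; rewrite !addr0 ch0 addr0.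
have key u : zgen (@U0Z_gens RS) u -> forall v : zalg (@U0Z_gens RS), zval v = u ->
    act u x = ch (pure q v 1) *: x.
  elim=> {u} [u [_ [a hu]]||u u' hu IHu hu' IHu'|u u' hu IHu hu' IHu'|z u hz hu IHu] v vu.
  - have [hk hki hb] := chgen a v; have [xk xki xb] := hx a.
    case: hu => [e|e|[r e]]; rewrite ?e; rewrite {}e in vu.
    + by rewrite hk.
    + by rewrite hki.
    by rewrite (hb r) // qk_binE xb.
  - by rewrite act1 (_ : v = 1) ?ch1 ?scale1r //; apply: val_inj.
  - rewrite actD ?(IHu (zelt hu)) ?(IHu' (zelt hu')) //; try exact: U0Z_sub.
    rewrite -scalerDl -chD -pureD; congr (ch (pure q _ _) *: _); exact: val_inj.
  - rewrite actM ?(IHu' (zelt hu')) //; try exact: U0Z_sub.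
    rewrite act_scale (IHu (zelt hu)) // scalerA mulrC -chM pureM mulr1.
    by congr (ch (pure q _ _) *: _); apply: val_inj.
  rewrite actZ ?(IHu (zelt hu)) //; try exact: U0Z_sub.
  rewrite scalerA -chZ -pureZ; congr (ch _ *: _).
  by rewrite -[ev q z]mulr1; apply/esym/pure_bal.
elim/tclW: H => s; rewrite tcl_sum; elim: s => [|y s IH].
  have i0 : U0_incl 0 = 0 :> Uq RS q.
    by apply: (addrI (U0_incl 0)); rewrite -U0_inclD // !addr0.
  by rewrite big_nil i0 ch0 scale0r; apply: (scale0r (x : L)).
rewrite !big_cons U0_inclD // U0_inclZ // UactD UactZ IH chD chZ scalerDl -scalerA.
by rewrite U0_pure_act (key _ (zvalP y.1) y.1).
Qed.

(** The line of a nonzero vector on which the generators act by scalars is stable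
   under U^0, and the resulting scalars form a character of weight [mu]. So
   characters exist at all weights that occur in a module. *)
Lemma wtvec_chi mu x : wtvec mu x -> x != 0 -> is_chi mu (chi (q := q) mu).
Proof.
move=> hx x0; have inj (c d : K) : c *: x = d *: x -> c = d.
  move/eqP; rewrite -subr_eq0 -scalerBl scaler_eq0 (negPf x0) orbF subr_eq0.
  by move/eqP.
have key u : zgen (@U0Z_gens RS) u -> exists c : K, act u x = c *: x.
  elim=> {u} [u [_ [a hu]]||u u' hu [c hc] hu' [d hd]|u u' hu [c hc] hu' [d hd]|z u hz hu [c hc]].
  - have [xk xki xb] := hx a.
    by case: hu => [->|->|[r ->]]; [exists (q ^ pairing mu a) | exists (q ^ (- pairing mu a)) |
       exists (ev q (qbin (pairing mu a) r)); rewrite qk_binE].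
  - by exists 1; rewrite act1 scale1r.
  - by exists (c + d); rewrite actD ?hc ?hd ?scalerDl //; apply: U0Z_sub.
  - by exists (d * c); rewrite actM ?hd ?act_scale ?hc ?scalerA //; apply: U0Z_sub.
  by exists (ev q z * c); rewrite actZ ?hc ?scalerA //; apply: U0Z_sub.
have scal H : exists c : K, Uact (U0_incl H) x = c *: x.
  elim/tclW: H => s; rewrite U0_incl_tcl // /spec0_sum; elim: s => [|y s [c hc]].
    by exists 0; rewrite big_nil !scale0r; apply: (scale0r (x : L)).
  have [d hd] := key _ (zvalP y.1); exists (y.2 * d + c).
  by rewrite big_cons UactD UactZ hc -[Uact _ x]/(act _ x) hd scalerDl scalerA.
pose ch H := sval (cid (scal H)).
have chE H : Uact (U0_incl H) x = ch H *: x by apply: (svalP (cid (scal H))).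
apply: (@xgetPex _ _ (is_chi mu)); exists ch; split.
- move=> c H H'; apply: inj; rewrite -chE U0_inclD // U0_inclZ // UactD UactZ !chE.
  by rewrite scalerDl scalerA.
- split; first by apply: inj; rewrite -chE U0_incl1 // Uact1 scale1r.
  move=> H H'; apply: inj; rewrite -chE U0_inclM // UactM chE linearZ /= chE.
  by rewrite !scalerA mulrC.
move=> a v; have [xk xki xb] := hx a; split=> [e|e|r e]; apply: inj.
- by rewrite -chE U0_pure_act e.
- by rewrite -chE U0_pure_act e.
by rewrite -chE U0_pure_act e qk_binE.
Qed.

Lemma wtvecP mu x : wtspace mu x <-> wtvec mu x.
Proof.
split; first exact: wtspace_wtvec.
move=> hx; have [->|x0] := eqVneq x 0; last exact: is_chi_act (wtvec_chi hx x0) hx.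
by move=> H; rewrite scaler0; apply: linear0.
Qed.

Lemma pairingD mu nu a : pairing (mu + nu) a = pairing mu a + pairing nu a.
Proof.
rewrite /pairing; have wP (m : weight RS) : rs_coroot (ssval a) (wval m) \is a Num.int.
  by case: m => w /= /allP; apply; apply: rs_base_roots; apply: ssvalP.
by rewrite -floorDzr // linearD.
Qed.

Lemma pairing_shift mu b n a :
  pairing (shift mu b n) a = pairing mu a + pairing (sroot b) a *+ n.
Proof.
rewrite /shift pairingD; congr (_ + _); elim: n => [|n IH]; last by rewrite !mulrS pairingD IH.
by apply: (addrI (pairing 0 a)); rewrite -pairingD !addr0.
Qed.

Lemma wtspace_E mu a n x : wtspace mu x -> wtspace (shift mu a n) (Uact (Ue q a n) x).
Proof.
move=> /wtvecP hx; apply/wtvecP; rewrite Ue_spec; apply: wtvec_shift hx; first exact: UZ_e.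
by move=> b; rewrite pairing_shift addrC addKr; apply: qwt_edp.
Qed.

Lemma wtspace_F mu a n x : wtspace (shift mu a n) x -> wtspace mu (Uact (Uf q a n) x).
Proof.
move=> /wtvecP hx; apply/wtvecP; rewrite Uf_spec; apply: wtvec_shift hx; first exact: UZ_f.
by move=> b; rewrite pairing_shift opprD addrA subrr add0r; apply: qwt_fdp.
Qed.

Lemma gspace_of_graded : weight_module L -> graded_ops (gspace_of L).
Proof.
move=> wL; split=> // a n _; split; try exact: Uact_linear.
  by move=> mu x; apply: wtspace_E.
by move=> mu x; apply: wtspace_F.
Qed.

(** The commutation formula acts on a weight vector: in
   [kbin a (2 r - m - n) r] the shift and the weight of [e^(m - r) x] add up to
   [<mu, a> + m + n]. *)
Lemma gspace_of_X2 : X2 q (gspace_of L).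
Proof.
move=> mu a b m n x m0 n0 hx; split=> [/eqP ab|ab].
  rewrite /= Ue_spec Uf_spec -!/(act _ _).
  by rewrite -(actM _ (UZ_e _ _) (UZ_f _ _)) qe_qf_comm // (actM _ (UZ_f _ _) (UZ_e _ _)).
rewrite -{}ab in hx *; rewrite [LHS]/= Ue_spec Uf_spec -!/(act _ _).
rewrite -(actM _ (UZ_e _ _) (UZ_f _ _)).
have UZt r : isUZ (qf_sub a n r * kbin a (r%:Z *+ 2 - m%:Z - n%:Z) r * qe_dp a (m - r)).
  apply: zgen_mul (UZ_e _ _); apply: zgen_mul (UZ_kbin _ _ _); exact: UZ_qf_sub.
rewrite qe_qf_dp /act spec_sum // Uact_sum.
rewrite (big_cat_nat _ (n := (minn m n).+1)) //; last by rewrite ltnS geq_minl.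
rewrite [X in _ + X = _]big1_seq ?addr0; last first.
  move=> r; rewrite mem_index_iota => /andP[_ /andP[mr rm]].
  rewrite /qf_sub ifF ?mul0r ?spec0 //; first exact: (scale0r (x : L)).
  by apply/negbTE; rewrite -ltnNge; move: mr; rewrite gtn_min ltnNge -ltnS rm.
apply: eq_big_nat => r /andP[_]; rewrite ltnS leq_min => /andP[rm rn].
rewrite /qf_sub rn -/(act _ _).
rewrite (actM _ (zgen_mul (UZ_f _ _) (UZ_kbin _ _ _)) (UZ_e _ _)).
rewrite (actM _ (UZ_f _ _) (UZ_kbin _ _ _)).
have hEx : wtvec (shift (shift mu a n) a (m - r)) (act (qe_dp a (m - r)) x).
  by apply/wtvecP; rewrite /act -Ue_spec; apply: wtspace_E.
rewrite (wtvec_kbin _ _ _ hEx) act_scale !pairing_shift sroot_pairing.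
congr (ev q (qbin _ _) *: _).
  have tw k : 2 *+ k = k%:Z *+ 2 :> int by rewrite -mulr_natr natz; ring.
  by rewrite !tw -subzn //; ring.
have e0 k y : act (qe_dp a k) y = gE0 (M := gspace_of L) a k y.
  by case: k => [|k]; rewrite ?qe_dp0 ?act1 //= Ue_spec.
have f0 k y : act (qf_dp a k) y = gF0 (M := gspace_of L) a k y.
  by case: k => [|k]; rewrite ?qf_dp0 ?act1 //= Uf_spec.
by rewrite e0 f0.
Qed.

End WeightVectors.

(** * Heights of weights *)

Section Heights.
Variable RS : rootSystem.
Implicit Types (mu nu lam : weight RS) (a : simple RS).

(** Height: the linear form with value 1 on every simple root. *)
Definition ht mu : rat := \sum_i coord (in_tuple (rs_base RS)) i (wval mu).

Lemma htD mu nu : ht (mu + nu) = ht mu + ht nu.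
Proof. by rewrite /ht -big_split; apply: eq_bigr => i _; rewrite linearD. Qed.

Lemma ht0 : ht 0 = 0.
Proof. by apply: (addrI (ht 0)); rewrite -htD !addr0. Qed.

Lemma ht_root a : ht (sroot a) = 1.
Proof.
have aB : ssval a \in rs_base RS := ssvalP a.
have ia : (index (ssval a) (rs_base RS) < size (rs_base RS))%N by rewrite index_mem.
have -> : ht (sroot a) = \sum_i (i == Ordinal ia)%:R.
  apply: eq_bigr => i _ /=; rewrite -{1}(nth_index 0 aB).
  have := @coord_free _ _ _ (in_tuple (rs_base RS)) (Ordinal ia) i (rs_base_free RS).
  by rewrite eq_sym.
by rewrite (bigD1 (Ordinal ia)) //= eqxx big1 ?addr0 // => i /negPf ->.
Qed.

Lemma htMn mu n : ht (mu *+ n) = ht mu * n%:R.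
Proof. by elim: n => [|n IH]; rewrite ?ht0 ?mulr0 // !mulrS htD IH mulrDr mulr1. Qed.

Lemma ht_shift mu a n : ht (shift mu a n) = ht mu + n%:R.
Proof. by rewrite /shift htD htMn ht_root mul1r. Qed.

Lemma ht_sum (c : simple RS -> nat) : ht (\sum_a sroot a *+ c a) = (\sum_a c a)%:R.
Proof.
rewrite natr_sum; elim/big_rec2: _ => [|a x y _ <-]; first exact: ht0.
by rewrite htD htMn ht_root mul1r.
Qed.

Lemma le_weight_refl mu : le_weight mu mu.
Proof. by exists (fun=> 0%N); rewrite subrr big1. Qed.

Lemma le_weight_trans mu nu lam : le_weight mu nu -> le_weight nu lam -> le_weight mu lam.
Proof.
move=> [c hc] [d hd]; exists (fun a => d a + c a)%N.
rewrite -[lam](subrK nu) -addrA hd hc -big_split.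
by apply: eq_bigr => a _; rewrite mulrnDr.
Qed.

Lemma le_shift mu a n : le_weight mu (shift mu a n).
Proof.
exists (fun b => if b == a then n else 0)%N; rewrite addrC addKr.
by rewrite (bigD1 a) //= eqxx big1 ?addr0 // => b /negPf ->.
Qed.

Lemma le_weight_ht mu lam : le_weight mu lam -> exists n : nat, ht lam = ht mu + n%:R.
Proof.
by move=> [c hc]; exists (\sum_a c a)%N; rewrite -ht_sum -hc -htD addrC subrK.
Qed.

Lemma le_weight_anti mu lam : le_weight mu lam -> le_weight lam mu -> mu = lam.
Proof.
move=> [c hc] /le_weight_ht[n hn].
have : ht lam = ht mu + (\sum_a c a)%:R by rewrite -ht_sum -hc -htD addrC subrK.
rewrite hn -addrA -[LHS]addr0 => /addrI /esym/eqP.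
rewrite -natrD pnatr_eq0 addn_eq0 => /andP[_ c0].
apply/esym/eqP; rewrite -subr_eq0 hc; apply/eqP/big1 => a _.
by move: c0; rewrite sum_nat_eq0 => /forallP /(_ a) /= /eqP ->.
Qed.

Lemma shift_neq mu a n : (0 < n)%N -> shift mu a n <> mu.
Proof.
move=> n0 /(congr1 ht)/eqP; rewrite ht_shift -subr_eq0 addrC addKr pnatr_eq0.
by rewrite eqn0Ngt n0.
Qed.

(** Downward induction from [lam]: the step from all [mu + n a] to [mu]
   terminates since heights below [lam] differ from [ht lam] by naturals. *)
Lemma ht_ind lam (P : weight RS -> Prop) :
  (forall mu, ~ le_weight mu lam -> P mu) ->
  (forall mu, le_weight mu lam ->
     (forall a n, (0 < n)%N -> P (shift mu a n)) -> P mu) ->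
  forall mu, P mu.
Proof.
move=> Pout Pin mu; have [mul|] := pselect (le_weight mu lam); last exact: Pout.
have [N] := le_weight_ht mul; elim/ltn_ind: N mu mul => N IH mu mul hN.
apply: Pin => // a n n0.
have [h|] := pselect (le_weight (shift mu a n) lam); last exact: Pout.
have [k hk] := le_weight_ht h; apply: (IH k) => //.
move: hk; rewrite hN ht_shift -addrA => /addrI /eqP; rewrite -natrD eqr_nat => /eqP ->.
by rewrite -[X in (X < _)%N]add0n ltn_add2r.
Qed.

Lemma shift_bound lam mu a n (N : nat) :
  ht lam = ht mu + N%:R -> le_weight (shift mu a n) lam -> (n <= N)%N.
Proof.
move=> hN /le_weight_ht[k]; rewrite hN ht_shift -addrA => /addrI /eqP.
by rewrite -natrD eqr_nat => /eqP ->; apply: leq_addr.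
Qed.

(** The coefficients of [lam - nu] are bounded by the difference of heights. *)
Lemma interval_finite lam mu :
  finite_set (fun nu => le_weight nu lam /\ le_weight mu nu).
Proof.
have [mul|nmul] := pselect (le_weight mu lam); last first.
  apply: (@sub_finite_set _ _ set0) => // nu [h1 h2]; case: nmul.
  exact: le_weight_trans h2 h1.
have [N hN] := le_weight_ht mul.
pose f (c : {ffun simple RS -> 'I_N.+1}) := lam - \sum_a sroot a *+ c a.
apply: (@sub_finite_set _ _ (range f)); last exact: finite_image.
move=> nu [[c hc] /le_weight_ht[k hk]].
have cN : (\sum_a c a <= N)%N.
  have : ht lam = ht nu + (\sum_a c a)%:R by rewrite -ht_sum -hc -htD addrC subrK.
  rewrite hN hk -addrA => /addrI /eqP; rewrite -natrD eqr_nat => /eqP ->.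
  exact: leq_addl.
exists [ffun a => inord (c a)] => //; rewrite /f.
rewrite (eq_bigr (fun a => sroot a *+ c a)) ?(-hc) => [|a _].
  by rewrite -hc opprB addrC subrK.
by rewrite ffunE inordK // ltnS (leq_trans _ cN) // (bigD1 a) //= leq_addr.
Qed.

End Heights.

(** * Bases of subspaces *)

Section FiniteDimension.
Variable K : fieldType.

Lemma subspace_lin (M : lmodType K) (P : set M) (I : Type) (s : seq I)
    (c : I -> K) (y : I -> M) :
  subspace P -> (forall i, P (y i)) -> P (\sum_(i <- s) c i *: y i).
Proof.
move=> [P0 Pl] hy; elim: s => [|i s IH]; first by rewrite big_nil.
by rewrite big_cons; apply: Pl.
Qed.

(** A subspace that embeds into a finitely spanned space has a basis: by the
   rank bound, an independent family of maximal length exists. *)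
Lemma fin_dim (M M' : lmodType K) (P : set M) (f : M -> M') (d : nat) (q : 'I_d -> M') :
  subspace P -> linear f -> (forall x, P x -> f x = 0 -> x = 0) ->
  (forall x, P x -> exists c : 'I_d -> K, f x = \sum_j c j *: q j) ->
  exists n, has_dim P n.
Proof.
move=> PS flin finj fspan; have [P0 Pl] := PS.
have f0 : f 0 = 0 by have := flin (-1) 0 0; rewrite !scaleN1r addNr addNr.
have fsum n (u : 'I_n -> K) (b : 'I_n -> M) :
    f (\sum_i u i *: b i) = \sum_i u i *: f (b i).
  by elim/big_rec2: _ => // i y1 y2 _ <-; rewrite flin.
pose indep n (b : 'I_n -> M) := (forall i, P (b i)) /\
  forall u : 'I_n -> K, \sum_i u i *: b i = 0 -> forall i, u i = 0.
have bound n b : indep n b -> (n <= d)%N.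
  move=> [bP bI]; rewrite leqNgt; apply/negP => dn.
  pose A := \matrix_(i < n, j < d) sval (cid (fspan _ (bP i))) j.
  have : kermx A != 0.
    by rewrite kermx_eq0 -row_leq_rank -ltnNge (leq_ltn_trans (rank_leq_col A)).
  move=> /rowV0Pn[u /sub_kermxP uA /negP]; apply.
  apply/eqP/rowP => i; rewrite mxE; apply: (bI (fun i => u 0 i)).
  apply: finj; first exact: subspace_lin.
  rewrite fsum.
  under eq_bigr => k _ do rewrite (svalP (cid (fspan _ (bP k)))) scaler_sumr.
  rewrite exchange_big big1 //= => j _; under eq_bigr do rewrite scalerA.
  rewrite -scaler_suml; move/rowP/(_ j): uA; rewrite !mxE.
  under eq_bigr do rewrite mxE.
  by move=> ->; rewrite scale0r.
pose ok n := `[< exists b : 'I_n -> M, indep n b >].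
have ex0 : exists n, ok n.
  exists 0%N; apply/asboolP; exists (fun=> 0); split; first by case.
  by move=> u _; case.
have ub n : ok n -> (n <= d)%N by move=> /asboolP[b]; apply: bound.
have [n /asboolP[b [bP bI]] nmax] := ex_maxnP ex0 ub.
exists n, b; split=> // x Px.
have [[u ex]|nex] := pselect (exists u : 'I_n -> K, x = \sum_i u i *: b i).
  exists (finfun u); split=> [|w ew]; first by rewrite ex; apply: eq_bigr => i _; rewrite ffunE.
  apply/ffunP => i; rewrite ffunE; apply/eqP; rewrite -subr_eq0; apply/eqP.
  apply: (bI (fun i => u i - w i)); under eq_bigr do rewrite scalerBl.
  by rewrite sumrB -ex -ew subrr.
have : ok n.+1; last by move/nmax; rewrite ltnn.
apply/asboolP; exists (fun i => if unlift ord0 i is Some j then b j else x); split.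
  by move=> i; case: unliftP => [j _|_].
move=> u; rewrite big_ord_recl unlift_none.
under eq_bigr do rewrite liftK.
move=> e; have u0 : u ord0 = 0.
  apply/eqP/negP => /negP u0; apply: nex; exists (fun i => - (u ord0)^-1 * u (lift ord0 i)).
  under eq_bigr do rewrite -scalerA.
  rewrite -scaler_sumr; move/eqP: e; rewrite addr_eq0 -eqr_oppLR => /eqP <-.
  by rewrite scaleNr scalerN opprK scalerA mulVf // scale1r.
move=> i; have [->//|[j ->]] : i = ord0 \/ exists j, i = lift ord0 j.
  by case: (unliftP ord0 i) => [j ->|->]; [right; exists j | left].
by apply: (bI (fun j => u (lift ord0 j))); move: e; rewrite u0 scale0r add0r.
Qed.

End FiniteDimension.

(** * Projections of a graded space *)

Section Projections.
Variables (RS : rootSystem) (K : fieldType) (M : lmodType K) (P : weight RS -> set M).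
Hypothesis dsP : direct_sum P.
Implicit Types (mu nu : weight RS) (x y : M) (f g : weight RS -> M).

Let PS mu : subspace (P mu). Proof. by have [] := dsP. Qed.

(** [f] is the family of components of [x]; its uniqueness makes the projections
   linear. *)
Let dec x f := (forall mu, P mu (f mu)) /\ exists s : seq (weight RS),
  [/\ uniq s, forall mu, mu \notin s -> f mu = 0 & x = \sum_(mu <- s) f mu].

Let supp_sum f s s' : uniq s -> uniq s' -> (forall mu, mu \notin s -> f mu = 0) ->
  (forall mu, mu \notin s' -> f mu = 0) -> \sum_(mu <- s) f mu = \sum_(mu <- s') f mu.
Proof.
move=> us us' fs fs'.
have nz (t : seq (weight RS)) : \sum_(mu <- t) f mu = \sum_(mu <- t | f mu != 0) f mu.
  rewrite [LHS](bigID (fun mu => f mu != 0)) /= [X in _ + X]big1 ?addr0 //.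
  by move=> mu /negPn/eqP.
rewrite nz [RHS]nz -big_filter -[RHS]big_filter.
apply/perm_big/uniq_perm; rewrite ?filter_uniq // => mu.
rewrite !mem_filter; case: eqP => //= /eqP fmu.
by apply/idP/idP => _; apply: contraNT fmu; [move/fs' | move/fs] => ->.
Qed.

Let dec_lin c x y f g : dec x f -> dec y g -> dec (c *: x + y) (fun mu => c *: f mu + g mu).
Proof.
move=> [Pf [s [us fs ->]]] [Pg [t [ut gt ->]]]; split.
  by move=> mu; have [_ h] := PS mu; apply: h.
pose r := undup (s ++ t).
have rf mu : mu \notin r -> f mu = 0 /\ g mu = 0.
  by rewrite mem_undup mem_cat negb_or => /andP[/fs -> /gt ->].
have ur : uniq r by apply: undup_uniq.
exists r; split=> //; first by move=> mu /rf[-> ->]; rewrite scaler0 addr0.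
rewrite big_split -scaler_sumr; congr (_ *: _ + _); apply: supp_sum => // mu.
  by case/rf.
by case/rf.
Qed.

Let dec_uniq x f g : dec x f -> dec x g -> f = g.
Proof.
move=> hf hg; have := dec_lin (-1) hf hg; rewrite scaleN1r addNr.
move=> [Ph [s [us hs e]]]; apply/funext => mu; have [_ _ h0] := dsP.
apply/eqP; rewrite eq_sym -subr_eq0 addrC -scaleN1r; apply/eqP.
have [mus|] := boolP (mu \in s); last exact: hs.
by apply: (h0 _ (fun mu => -1 *: f mu + g mu)) mus.
Qed.

Let dec_homog nu x : P nu x -> dec x (fun mu => if mu == nu then x else 0).
Proof.
move=> Px; split; first by move=> mu; case: eqP => [->//|_]; have [] := PS mu.
exists [:: nu]; split=> //; last by rewrite big_seq1 eqxx.
by move=> mu; rewrite inE => /negPf ->.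
Qed.

Let dec_ex x : exists f, dec x f.
Proof.
have [_ /(_ x)[s [y [Py ->]]] _] := dsP; elim: s => [|mu s [f hf]].
  exists (fun=> 0); split; first by move=> mu; have [] := PS mu.
  by exists [::]; split=> //; rewrite !big_nil.
exists (fun nu => 1 *: (if nu == mu then y mu else 0) + f nu).
by rewrite big_cons -[y mu]scale1r; apply: dec_lin => //; rewrite scale1r; apply: dec_homog.
Qed.

Definition pr mu x : M := sval (cid (dec_ex x)) mu.

Let pr_dec x : dec x (pr^~ x).
Proof. exact: (svalP (cid (dec_ex x))). Qed.

Lemma pr_in mu x : P mu (pr mu x).
Proof. by have [] := pr_dec x. Qed.

Lemma pr_linear mu c x y : pr mu (c *: x + y) = c *: pr mu x + pr mu y.
Proof. by have := dec_uniq (pr_dec _) (dec_lin c (pr_dec x) (pr_dec y)) => /(congr1 (@^~ mu)). Qed.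

Lemma pr_id mu x : P mu x -> pr mu x = x.
Proof.
by move=> /dec_homog h; have := dec_uniq (pr_dec x) h => /(congr1 (@^~ mu)); rewrite eqxx.
Qed.

Lemma pr_neq mu nu x : P nu x -> mu != nu -> pr mu x = 0.
Proof.
move=> /dec_homog h /negPf mn; have := dec_uniq (pr_dec x) h => /(congr1 (@^~ mu)).
by rewrite mn.
Qed.

Lemma pr_sum x : exists s, x = \sum_(mu <- s) pr mu x.
Proof. by have [_ [s [_ _]]] := pr_dec x; exists s. Qed.

Lemma pr0 mu : pr mu 0 = 0.
Proof. by apply: pr_id; have [] := PS mu. Qed.

End Projections.

(** * Subspaces generated by divided powers *)

Section GradedSpans.
Variables (RS : rootSystem) (K : fieldType) (q : K).
Implicit Types (M : gspace RS K) (mu nu : weight RS) (a b : simple RS).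

Lemma shiftC mu a b m n : shift (shift mu a m) b n = shift (shift mu b n) a m.
Proof. by rewrite /shift addrAC. Qed.

Lemma shift_shift mu a m n : shift (shift mu a m) a n = shift mu a (m + n).
Proof. by rewrite /shift mulrnDr addrA. Qed.

(** [graded_ops] with the direct sum decomposition weakened to subspaces, a form
   that is immediate for a product of two objects. *)
Definition graded_maps M : Prop :=
  (forall mu, subspace (@gcomp _ _ M mu)) /\ (forall a n, (0 < n)%N ->
    [/\ linear (gE a n : M -> M), linear (gF a n : M -> M),
        forall mu (x : M), gcomp mu x -> gcomp (shift mu a n) (gE a n x) &
        forall mu (x : M), gcomp (shift mu a n) x -> gcomp mu (gF a n x)]).

Lemma graded_ops_maps M : graded_ops M -> graded_maps M.
Proof. by move=> [[]]. Qed.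

Lemma linear_0 (U V : lmodType K) (f : U -> V) : linear f -> f 0 = 0.
Proof. by move=> /(_ (-1) 0 0); rewrite !scaleN1r !addNr. Qed.

(** Generation is indexed by the weight, since the commutation rule needed to
   compute E on generated vectors depends on it. *)
Inductive fgen M (G : weight RS -> set M) : weight RS -> M -> Prop :=
  | fgen_in mu x : G mu x -> fgen G mu x
  | fgen_0 mu : fgen G mu 0
  | fgen_lin mu c x y : fgen G mu x -> fgen G mu y -> fgen G mu (c *: x + y)
  | fgen_F mu a n x : (0 < n)%N -> fgen G (shift mu a n) x -> fgen G mu (gF a n x).

Inductive hull M (P : weight RS -> set M) : M -> Prop :=
  | hull_0 : hull P 0
  | hull_lin c x y : hull P x -> hull P y -> hull P (c *: x + y)
  | hull_in mu x : P mu x -> hull P x.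

(** An inductive form of [imF], to which it is compared in [spanF_imF]. *)
Inductive spanF M (Q : weight RS -> set M) mu : M -> Prop :=
  | spanF_0 : spanF Q mu 0
  | spanF_lin c x y : spanF Q mu x -> spanF Q mu y -> spanF Q mu (c *: x + y)
  | spanF_F a n x : (0 < n)%N -> Q (shift mu a n) x -> spanF Q mu (gF a n x).

Section FixedObject.
Variable M : gspace RS K.
Hypothesis gM : graded_maps M.
Implicit Types (x y z : M) (G P Q : weight RS -> set M).

Lemma gcompD mu x y : gcomp mu x -> gcomp mu y -> gcomp mu (x + y).
Proof. by have [_ h] := gM.1 mu => hx hy; rewrite -[x]scale1r; apply: h. Qed.

Lemma gE_0 a n : (0 < n)%N -> gE a n 0 = 0 :> M.
Proof. by move=> /(gM.2 a)[/linear_0]. Qed.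
Lemma gF_0 a n : (0 < n)%N -> gF a n 0 = 0 :> M.
Proof. by move=> /(gM.2 a)[_ /linear_0]. Qed.
Lemma gE_lin a n : (0 < n)%N -> linear (gE a n : M -> M).
Proof. by move=> /(gM.2 a)[]. Qed.
Lemma gF_lin a n : (0 < n)%N -> linear (gF a n : M -> M).
Proof. by move=> /(gM.2 a)[]. Qed.

Lemma fgen_subspace G mu : subspace (fgen G mu).
Proof. by split=> [|c x y]; [apply: fgen_0 | apply: fgen_lin]. Qed.

Lemma hull_subspace P : subspace (hull P).
Proof. by split=> [|c x y]; [apply: hull_0 | apply: hull_lin]. Qed.

Lemma fgen_gcomp G : (forall mu x, G mu x -> gcomp mu x) ->
  forall mu x, fgen G mu x -> gcomp mu x.
Proof.
move=> GM mu x; elim=> {mu x} [mu x /GM //|mu|mu c x y _ hx _ hy|mu a n x n0 _ hx].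
- by have [] := gM.1 mu.
- by have [_] := gM.1 mu; apply.
by have [_ _ _] := gM.2 a n n0; apply.
Qed.

Lemma subspace_sum (P : set M) (I : eqType) (s : seq I) (F : I -> M) :
  subspace P -> (forall i, i \in s -> P (F i)) -> P (\sum_(i <- s) F i).
Proof.
move=> [P0 Pl] h; rewrite big_seq; elim/big_ind: _ => // x y Px Py.
by rewrite -[x]scale1r; apply: Pl.
Qed.

(** Vectors killed by all E generate, under the F, a family stable under the E:
   the commutation rule moves each E to the right through the F. *)
Lemma fgen_E G : X2 q M -> (forall mu x, G mu x -> kerE mu x) ->
  forall mu x a m, (0 < m)%N -> fgen G mu x -> fgen G (shift mu a m) (gE a m x).
Proof.
move=> M2 GM mu x a m m0 h; elim: h a m m0 => {mu x}
  [mu x /GM[_ h]|mu|mu c x y _ hx _ hy|mu b n x n0 gx IH] a m m0.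
- by rewrite h //; apply: fgen_0.
- by rewrite gE_0 //; apply: fgen_0.
- by rewrite (gE_lin a m0); apply: fgen_lin; [apply: hx | apply: hy].
have cx : gcomp (shift mu b n) x by apply: fgen_gcomp gx => nu y /GM[].
have [ne eq_] := M2 mu a b m n x m0 n0 cx; have [ab|/ne ->] := pselect (a = b); last first.
  by apply: fgen_F => //; rewrite shiftC; apply: IH.
move: IH gx cx eq_; rewrite -ab => IH gx cx ->; last by [].
apply: subspace_sum => [|r]; first exact: fgen_subspace.
rewrite mem_index_iota ltnS leq_min => /andP[_ /andP[rm rn]].
have hE : fgen G (shift (shift mu a n) a (m - r)) (gE0 a (m - r) x).
  case: (m - r)%N => [|k] /=; last by apply: IH.
  by rewrite /shift mulr0n addr0.
have hF nu k z : fgen G (shift nu a k) z -> fgen G nu (gF0 a k z).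
  case: k => [|k] /=; first by rewrite /shift mulr0n addr0.
  exact: fgen_F.
rewrite -[X in fgen _ _ X]addr0; apply: fgen_lin; last exact: fgen_0.
apply: hF; move: hE; rewrite !shift_shift.
by rewrite addnBA // [(n + m)%N]addnC -addnBA.
Qed.

(** If no weight above [mu] occurs, F contributes nothing in weight [mu]. *)
Lemma fgen_top G mu (R : set M) : (forall nu x, G nu x -> gcomp nu x) ->
  (forall a n x, (0 < n)%N -> gcomp (shift mu a n) x -> x = 0) ->
  subspace R -> (forall x, G mu x -> R x) -> forall x, fgen G mu x -> R x.
Proof.
move=> GM top [R0 Rl] GR x h; have GM' := fgen_gcomp GM.
elim: h top GR => {mu x} [mu x hx _ GR|//|mu c x y _ hx _ hy top GR|mu a n x n0 gx _ top _].
- exact: GR.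
- by apply: Rl; [apply: hx | apply: hy].
by rewrite (top a n x n0) ?gF_0 //; apply: GM'.
Qed.

(** The generators account for [y]; everything else was produced by an F. *)
Lemma fgen_split G mu (R : set M) : subspace R -> (forall x, G mu x -> R x) ->
  forall x, fgen G mu x -> exists y z, [/\ R y, spanF (fgen G) mu z & x = y + z].
Proof.
move=> [R0 Rl] GR x h.
elim: h GR => {mu x} [mu x hx GR|mu _|mu c x y _ hx _ hy GR|mu a n x n0 gx _ _].
- by exists x, 0; rewrite addr0; split; [apply: GR | apply: spanF_0 |].
- by exists 0, 0; rewrite addr0; split => //; apply: spanF_0.
- have [x1 [x2 [h1 h2 ->]]] := hx GR; have [y1 [y2 [h3 h4 ->]]] := hy GR.
  exists (c *: x1 + y1), (c *: x2 + y2); split; [exact: Rl|exact: spanF_lin|].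
  by rewrite scalerDr addrACA.
by exists 0, (gF a n x); rewrite add0r; split=> //; apply: spanF_F.
Qed.

Lemma spanF_mono Q Q' mu : (forall nu x, Q nu x -> Q' nu x) ->
  forall z, spanF Q mu z -> spanF Q' mu z.
Proof.
move=> QQ z; elim=> {z} [|c x y _ hx _ hy|a n x n0 /QQ hx].
- exact: spanF_0.
- exact: spanF_lin.
exact: spanF_F.
Qed.

Lemma spanF_gcomp mu z : spanF (@gcomp _ _ M) mu z -> gcomp mu z.
Proof.
elim=> {z} [|c x y _ hx _ hy|a n x n0 hx].
- by have [] := gM.1 mu.
- by have [_] := gM.1 mu; apply.
by have [_ _ _] := gM.2 a n n0; apply.
Qed.

Lemma spanF_imF mu z : spanF (@gcomp _ _ M) mu z <-> imF mu z.
Proof.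
have C0 nu : gcomp nu (0 : M) by have [] := gM.1 nu.
split; last first.
  move=> [w [N [hw ->]]].
  have SS : subspace (spanF (@gcomp _ _ M) mu).
    by split=> [|c x y]; [apply: spanF_0 | apply: spanF_lin].
  apply: subspace_sum => // a _; apply: subspace_sum => // n.
  by rewrite mem_index_iota => /andP[n0 _]; apply: spanF_F => //; case: (hw a n n0).
have ext (w : simple RS -> nat -> M) N N' : delta_elt mu w N -> (N <= N')%N ->
    \sum_a \sum_(1 <= n < N.+1) gF a n (w a n) = \sum_a \sum_(1 <= n < N'.+1) gF a n (w a n).
  move=> hw NN; apply: eq_bigr => a _; rewrite [RHS](big_cat_nat _ (n := N.+1)) //=.
  rewrite [X in _ = _ + X]big1_seq ?addr0 // => n.
  rewrite mem_index_iota => /andP[_ /andP[Nn _]].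
  have n0 : (0 < n)%N by apply: leq_trans Nn.
  by have [_ hN] := hw a n n0; rewrite (hN Nn) gF_0.
elim=> {z} [|c x y _ [w [N [hw ->]]] _ [w' [N' [hw' ->]]]|a n x n0 hx].
- exists (fun _ _ => 0), 0%N; split; first by [].
  by apply/esym/big1 => a _; rewrite big_geq.
- exists (fun a n => c *: w a n + w' a n), (maxn N N'); split.
    move=> a n n0; have [h1 h2] := hw a n n0; have [h3 h4] := hw' a n n0; split.
      by have [_] := gM.1 (shift mu a n); apply.
    by rewrite gtn_max => /andP[/h2 -> /h4 ->]; rewrite scaler0 addr0.
  rewrite (ext w N (maxn N N')) ?leq_maxl // (ext w' N' (maxn N N')) ?leq_maxr //.
  rewrite scaler_sumr -big_split; apply: eq_bigr => a _.
  rewrite scaler_sumr -big_split; apply: eq_big_nat => n /andP[n0 _] /=.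
  by rewrite (gF_lin a n0).
exists (fun b k => if (b == a) && (k == n) then x else 0), n; split.
  move=> b k k0; split; first by case: andP => // -[/eqP -> /eqP ->].
  by move=> nk; rewrite [k == n]gtn_eqF // andbF.
rewrite (bigD1 a) //= [X in _ + X]big1 ?addr0 => [|b /negPf ba]; last first.
  by rewrite big_nat big1 // => k /andP[k0 _]; rewrite ba gF_0.
rewrite big_nat_recr //= !eqxx big_nat big1 ?add0r // => k /andP[k0 kn].
by rewrite (ltn_eqF kn) andbF gF_0.
Qed.

Lemma hull_E P : (forall mu a n x, (0 < n)%N -> P mu x -> P (shift mu a n) (gE a n x)) ->
  forall a n x, (0 < n)%N -> hull P x -> hull P (gE a n x).
Proof.
move=> h a n x n0; elim=> {x} [|c x y _ hx _ hy|mu x hx].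
- by rewrite gE_0 //; apply: hull_0.
- by rewrite (gE_lin a n0); apply: hull_lin.
exact: hull_in (h mu a n x n0 hx).
Qed.

Lemma hull_F P : (forall mu a n x, (0 < n)%N -> P mu x -> hull P (gF a n x)) ->
  forall a n x, (0 < n)%N -> hull P x -> hull P (gF a n x).
Proof.
move=> h a n x n0; elim=> {x} [|c x y _ hx _ hy|mu x hx].
- by rewrite gF_0 //; apply: hull_0.
- by rewrite (gF_lin a n0); apply: hull_lin.
exact: h n0 hx.
Qed.

End FixedObject.

Lemma hull_pr M (dM : direct_sum (@gcomp _ _ M)) (P : weight RS -> set M) :
  (forall mu, subspace (P mu)) -> (forall mu x, P mu x -> gcomp mu x) ->
  forall x, hull P x -> forall mu, P mu (pr dM mu x).
Proof.
move=> PS PM x; elim=> {x} [|c x y _ hx _ hy|nu x hx] mu.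
- by rewrite pr0; have [] := PS mu.
- by rewrite pr_linear; have [_] := PS mu; apply.
have [->|mn] := eqVneq mu nu; first by rewrite pr_id //; apply: PM.
by rewrite (pr_neq dM (PM _ _ hx) mn); have [] := PS mu.
Qed.

Lemma hull_all M : direct_sum (@gcomp _ _ M) -> forall x : M, hull (@gcomp _ _ M) x.
Proof.
move=> dM x; have [s ->] := pr_sum dM x; apply: subspace_sum => [|mu _].
  exact: hull_subspace.
by apply: (@hull_in _ _ mu); apply: pr_in.
Qed.

Lemma hull_mono M (P Q : weight RS -> set M) : (forall mu x, P mu x -> Q mu x) ->
  forall x, hull P x -> hull Q x.
Proof.
move=> h x; elim=> {x} [|c x y _ hx _ hy|mu x /h hx]; first exact: hull_0.
  exact: hull_lin.
exact: hull_in hx.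
Qed.

Lemma hull_homog M (dM : direct_sum (@gcomp _ _ M)) (P : weight RS -> set M) :
  (forall mu, subspace (P mu)) -> (forall mu x, P mu x -> gcomp mu x) ->
  forall mu x, gcomp mu x -> hull P x -> P mu x.
Proof. by move=> PS PM mu x hx /(hull_pr dM PS PM)/(_ mu); rewrite pr_id. Qed.

End GradedSpans.

(** * Subobjects and biproducts *)

Section SubType.
Variables (RS : rootSystem) (K : fieldType) (M : gspace RS K) (P : weight RS -> set M).

Definition hullb : pred M := fun x => `[< hull P x >].
Record hullT := HullT { hval : M; _ : hullb hval }.
HB.instance Definition _ := [isSub for hval].
HB.instance Definition _ := [Choice of hullT by <:].

Fact hullb_submod : submod_closed hullb.
Proof.
split; first by apply/asboolP; apply: hull_0.
by move=> c x y /asboolP hx /asboolP hy; apply/asboolP; apply: hull_lin.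
Qed.
HB.instance Definition _ := GRing.isSubmodClosed.Build K M hullb hullb_submod.
HB.instance Definition _ := [SubChoice_isSubLmodule of hullT by <:].

Lemma hvalP (x : hullT) : hull P (hval x).
Proof. by apply/asboolP; case: x. Qed.

(** Elements outside the span are sent to 0. This also gives values to the
   operators of index 0, about which nothing is assumed. *)
Definition hinj (x : M) : hullT := insubd 0 x.

Lemma hvalK x : hull P x -> hval (hinj x) = x.
Proof. by move=> hx; apply: (@insubdK _ _ hullT 0 x); apply/asboolP. Qed.

Lemma hval_inj : injective hval.
Proof. exact: val_inj. Qed.

Lemma hval_linear : linear hval.
Proof. exact: (linearP (val : hullT -> M)). Qed.

Definition subg : gspace RS K := @GSpace RS K hullT (fun mu x => P mu (hval x))
  (fun a n x => hinj (gE a n (hval x))) (fun a n x => hinj (gF a n (hval x))).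

End SubType.

Section SubObject.
Variables (RS : rootSystem) (K : fieldType) (q : K) (M : gspace RS K).
Hypothesis MX : in_X q M.

(** Families of graded pieces that form subobjects. The last condition is the part
   of (X3) that a subobject does not inherit. *)
Record subfamily (P : weight RS -> set M) : Prop := Subfamily {
  sf_sub : forall mu, subspace (P mu);
  sf_comp : forall mu x, P mu x -> gcomp mu x;
  sf_E : forall mu a n x, (0 < n)%N -> P mu x -> P (shift mu a n) (gE a n x);
  sf_F : forall mu a n x, (0 < n)%N -> P (shift mu a n) x -> P mu (gF a n x);
  sf_split : forall mu x, P mu x ->
    exists y z, [/\ kerE mu y, P mu y, spanF P mu z & x = y + z] }.

Let Mgr : graded_ops M. Proof. by case: MX. Qed.
Let dM : direct_sum (@gcomp _ _ M) := Mgr.1.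
Let gM : graded_maps M := graded_ops_maps Mgr.

Lemma sf_hull_F P : subfamily P -> forall a n x, (0 < n)%N -> hull P x -> hull P (gF a n x).
Proof.
move=> sP a n x n0; apply: (hull_F gM) n0 => {a n x} mu a n x n0 hx.
apply: (@hull_in _ _ _ _ (mu - sroot a *+ n)); apply: sf_F => //.
by rewrite /shift subrK.
Qed.

Lemma sf_hull_E P : subfamily P -> forall a n x, (0 < n)%N -> hull P x -> hull P (gE a n x).
Proof. by move=> sP a n x n0; apply: (hull_E gM) n0 => {a n x} *; apply: sf_E. Qed.

Section OneFamily.
Variable P : weight RS -> set M.
Hypothesis sP : subfamily P.
Local Notation S := (subg P).
Local Notation hv := (@hval RS K M P).

Lemma hval_gE a n (x : S) : (0 < n)%N -> hv (gE a n x) = gE a n (hv x).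
Proof. by move=> n0; apply/hvalK/sf_hull_E => //; apply: hvalP. Qed.
Lemma hval_gF a n (x : S) : (0 < n)%N -> hv (gF a n x) = gF a n (hv x).
Proof. by move=> n0; apply/hvalK/sf_hull_F => //; apply: hvalP. Qed.

Lemma hval_sum (I : Type) (s : seq I) (F : I -> S) :
  hv (\sum_(i <- s) F i) = \sum_(i <- s) hv (F i).
Proof. exact: (raddf_sum (val : hullT P -> M)). Qed.
Lemma hvalZ c (x : S) : hv (c *: x) = c *: hv x.
Proof. exact: (linearZ_LR (val : hullT P -> M)). Qed.
Lemma hvalD (x y : S) : hv (x + y) = hv x + hv y.
Proof. exact: (raddfD (val : hullT P -> M)). Qed.
Lemma hval0 : hv 0 = 0.
Proof. exact: (raddf0 (val : hullT P -> M)). Qed.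

Lemma subg_graded : graded_ops S.
Proof.
split.
  split=> [mu|x|s y us hy e mu mus].
  - have [P0 Pl] := sf_sub sP mu; split=> [|c x y hx hy].
      by change (P mu (hv 0)); rewrite hval0.
    by change (P mu (hv (c *: x + y))); rewrite hvalD hvalZ; apply: Pl.
  - have [s es] := pr_sum dM (hv x).
    have hP mu : P mu (pr dM mu (hv x)).
      exact: (hull_pr dM (sf_sub sP) (sf_comp sP) (hvalP x)).
    have hK mu : hv (hinj P (pr dM mu (hv x))) = pr dM mu (hv x).
      exact/hvalK/hull_in/hP.
    exists s, (fun mu => hinj P (pr dM mu (hv x))); split=> [mu|]; first by rewrite /= hK.
    by apply: hval_inj; rewrite hval_sum {1}es; apply: eq_bigr => mu _; rewrite hK.
  apply: hval_inj; rewrite hval0; have [_ _ h] := dM.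
  apply: (h s (fun mu => hv (y mu))) mus => // [nu|]; first exact: (sf_comp sP) (hy nu).
  by rewrite -hval_sum e hval0.
move=> a n n0; split=> [c x y|c x y|mu x hx|mu x hx].
- by apply: hval_inj; rewrite hvalD hvalZ !hval_gE // hvalD hvalZ (gE_lin gM a n0).
- by apply: hval_inj; rewrite hvalD hvalZ !hval_gF // hvalD hvalZ (gF_lin gM a n0).
- by have := sf_E sP a n0 hx; rewrite -hval_gE.
by have := sf_F sP n0 hx; rewrite -hval_gF.
Qed.

Lemma subg_spanF mu z : spanF P mu z -> spanF (@gcomp _ _ S) mu (hinj P z).
Proof.
have hS z' : spanF P mu z' -> hull P z'.
  move=> h; apply: (@hull_in _ _ _ _ mu); elim: h => {z'} [|c x y _ hx _ hy|a n x n0 hx].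
  - by have [] := sf_sub sP mu.
  - by have [_] := sf_sub sP mu; apply.
  exact: sf_F.
elim=> {z} [|c x y hx IHx hy IHy|a n x n0 hx].
- have -> : hinj P 0 = 0 by apply: hval_inj; rewrite hvalK ?hval0 //; apply: hull_0.
  exact: spanF_0.
- have -> : hinj P (c *: x + y) = c *: hinj P x + hinj P y.
    apply: hval_inj; rewrite hvalD hvalZ !hvalK //; try exact: hS.
    by apply: hull_lin; apply: hS.
  exact: spanF_lin.
have hx' := hull_in hx.
have -> : hinj P (gF a n x) = gF a n (hinj P x : S).
  by apply: hval_inj; rewrite hval_gF // !hvalK //; apply: sf_hull_F.
by apply: spanF_F => //=; rewrite hvalK.
Qed.

Lemma subg_in_X : in_X q S.
Proof.
have [_ [qb fd] M2 M3] := MX; split.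
- exact: subg_graded.
- split.
    move=> mu; apply: sub_finite_set (qb mu) => nu [[x hx x0] le]; split=> //.
    exists (hv x); first exact: (sf_comp sP).
    by move=> e; apply: x0; apply: hval_inj; rewrite hval0.
  move=> mu; have [d [b [_ hb]]] := fd mu.
  apply: (@fin_dim _ _ M _ hv d b).
  + by have [[]] := subg_graded.
  + exact: hval_linear.
  + by move=> x _ e; apply: hval_inj; rewrite hval0.
  by move=> x /(sf_comp sP)/hb[c [-> _]]; exists c.
- move=> mu a b m n x m0 n0 hx; have [ne eq_] := M2 mu a b m n (hv x) m0 n0 (sf_comp sP hx).
  split=> ab; first by apply: hval_inj; rewrite !(hval_gE, hval_gF) // ne.
  apply: hval_inj; rewrite !(hval_gE, hval_gF) // eq_ // hval_sum.
  apply: eq_bigr => r _; rewrite hvalZ; congr (_ *: _).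
  have e0 k (y : S) : hv (gE0 a k y) = gE0 a k (hv y) by case: k => // k; apply: hval_gE.
  have f0 k (y : S) : hv (gF0 a k y) = gF0 a k (hv y) by case: k => // k; apply: hval_gF.
  by rewrite f0 e0.
have kerS mu (x : S) : kerE mu x -> kerE mu (hv x).
  move=> [hx ex]; split; first exact: (sf_comp sP).
  by move=> a n n0; rewrite -hval_gE // ex // hval0.
have imS mu (x : S) : imF mu x -> imF mu (hv x).
  move=> /(spanF_imF (graded_ops_maps subg_graded)) h; apply/(spanF_imF gM).
  elim: h => {x} [|c x y _ hx _ hy|a n x n0 hx].
  - by rewrite hval0; apply: spanF_0.
  - by rewrite hvalD hvalZ; apply: spanF_lin.
  by rewrite hval_gF //; apply: spanF_F => //; apply: (sf_comp sP).
move=> mu; split=> x; last first.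
  move=> /kerS kx /imS ix; have [_ h] := M3 mu.
  by apply: hval_inj; rewrite hval0; apply: h.
split=> [hx|[y [z [[hy _] iz ->]]]]; last first.
  apply: (gcompD (graded_ops_maps subg_graded)) => //.
  apply: (spanF_gcomp (graded_ops_maps subg_graded)).
  by apply/(spanF_imF (graded_ops_maps subg_graded)).
have [y [z [ky Py sz e]]] := sf_split sP hx.
have hy := hull_in Py; exists (hinj P y), (hinj P z); split.
- split; first by rewrite /= hvalK.
  move=> a n n0; apply: hval_inj; rewrite hval_gE // hvalK // hval0.
  by have [_ ->] := ky.
- by apply/(spanF_imF (graded_ops_maps subg_graded)); apply: subg_spanF.
apply: hval_inj; rewrite hvalD !hvalK //.
have -> : z = -1 *: y + hv x by rewrite e scaleN1r addKr.
by apply: hull_lin => //; apply: hvalP.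
Qed.

Lemma hval_hom : X_hom (hv : S -> M).
Proof.
split; first exact: hval_linear.
  by move=> mu x; apply: (sf_comp sP).
by move=> a n x n0; rewrite hval_gE ?hval_gF.
Qed.

End OneFamily.

Lemma hull_disjoint P Q : subfamily P -> subfamily Q ->
  (forall mu x, P mu x -> Q mu x -> x = 0) -> forall x, hull P x -> hull Q x -> x = 0.
Proof.
move=> sP sQ PQ0 x hp hq; have [s ->] := pr_sum dM x; apply: big1 => mu _.
apply: (PQ0 mu); first exact: (hull_pr dM (sf_sub sP) (sf_comp sP)).
exact: (hull_pr dM (sf_sub sQ) (sf_comp sQ)).
Qed.

(** Components along a complement are unique, hence the projection is linear and
   commutes with the operators. *)
Lemma family_proj P Q : subfamily P -> subfamily Q ->
  (forall mu x, P mu x -> Q mu x -> x = 0) ->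
  (forall mu x, gcomp mu x -> exists a b, [/\ P mu a, Q mu b & x = a + b]) ->
  exists p : M -> subg P, X_hom p /\ forall x, hull Q (x - hval (p x)).
Proof.
move=> sP sQ PQ0 PQ.
have disj := hull_disjoint sP sQ PQ0.
have [_ Pl] := hull_subspace P; have [_ Ql] := hull_subspace Q.
have ex x : exists a, hull P a /\ hull Q (x - a).
  elim: (hull_all dM x) => {x} [|c x y _ [a [pa qa]] _ [b [pb qb]]|mu x /PQ[a [b [pa qb ->]]]].
  - by exists 0; rewrite subr0; split; apply: hull_0.
  - exists (c *: a + b); split; first exact: hull_lin.
    have -> : c *: x + y - (c *: a + b) = c *: (x - a) + (y - b).
      by rewrite scalerBr opprD addrACA.
    exact: hull_lin.
  by exists a; rewrite addrC addKr; split; apply: (@hull_in _ _ _ _ mu).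
pose p0 x := sval (cid (ex x)).
have [p0P p0Q] : (forall x, hull P (p0 x)) /\ (forall x, hull Q (x - p0 x)).
  by split=> x; have [] := svalP (cid (ex x)).
have p0u x a : hull P a -> hull Q (x - a) -> p0 x = a.
  move=> pa qa; apply/eqP; rewrite -subr_eq0; apply/eqP/disj.
    by rewrite addrC -scaleN1r; apply: Pl.
  have -> : p0 x - a = -1 *: (x - p0 x) + (x - a).
    by rewrite scaleN1r opprB addrA subrK.
  exact: Ql.
have pK x : hval (hinj P (p0 x)) = p0 x by apply: hvalK.
exists (fun x => hinj P (p0 x)); split; last by move=> x; rewrite pK.
split=> [c x y|mu x hx|a n x n0].
- apply: hval_inj; rewrite hval_linear !pK; apply: p0u; first exact: Pl.
  have -> : c *: x + y - (c *: p0 x + p0 y) = c *: (x - p0 x) + (y - p0 y).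
    by rewrite scalerBr opprD addrACA.
  exact: Ql.
- rewrite /= pK; have [a [b [pa qb e]]] := PQ mu x hx.
  rewrite (p0u x a) //; first exact: hull_in pa.
  by rewrite e addrC addKr; apply: hull_in qb.
have subl f : linear f -> f x - f (p0 x) = f (x - p0 x) :> M.
  by move=> fl; rewrite addrC -scaleN1r -fl scaleN1r addrC.
split; apply: hval_inj; rewrite ?hval_gE ?hval_gF // !pK; apply: p0u.
- exact: sf_hull_E.
- by rewrite (subl _ (gE_lin gM a n0)); apply: sf_hull_E.
- exact: sf_hull_F.
by rewrite (subl _ (gF_lin gM a n0)); apply: sf_hull_F.
Qed.

Lemma family_biproduct P Q : subfamily P -> subfamily Q ->
  (forall mu x, P mu x -> Q mu x -> x = 0) ->
  (forall mu x, gcomp mu x -> exists a b, [/\ P mu a, Q mu b & x = a + b]) ->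
  is_biproduct M (subg P) (subg Q).
Proof.
move=> sP sQ PQ0 PQ; have [pA [hA hAq]] := family_proj sP sQ PQ0 PQ.
have [|mu x|pB [hB hBp]] := family_proj sQ sP.
- by move=> mu x hq hp; apply: PQ0 hp hq.
- by move=> /PQ[a [b [ha hb ->]]]; exists b, a; rewrite addrC.
have disj := hull_disjoint sP sQ PQ0.
have [_ Pl] := hull_subspace P; have [_ Ql] := hull_subspace Q.
have subP x y : hull P x -> hull P y -> hull P (x - y).
  by move=> hx hy; rewrite addrC -scaleN1r; apply: Pl.
have subQ x y : hull Q x -> hull Q y -> hull Q (x - y).
  by move=> hx hy; rewrite addrC -scaleN1r; apply: Ql.
exists (@hval _ _ _ P), pA, (@hval _ _ _ Q), pB; split.
- by split=> //; apply: hval_hom.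
- move=> x; apply/hval_inj/esym/eqP; rewrite -subr_eq0; apply/eqP/disj => //.
  by apply: subP; apply: hvalP.
- move=> x; apply/hval_inj/esym/eqP; rewrite -subr_eq0; apply/eqP/disj => //.
  by apply: subQ; apply: hvalP.
- split=> x; apply: hval_inj; rewrite hval0; apply: disj; try exact: hvalP.
    have := subQ _ _ (hvalP x) (hAq (hval x)).
    by rewrite opprB addrC subrK.
  have := subP _ _ (hvalP x) (hBp (hval x)).
  by rewrite opprB addrC subrK.
move=> x; apply/esym/eqP; rewrite -subr_eq0; apply/eqP/disj.
  by rewrite opprD addrCA addrC; apply: subP => //; apply: hvalP.
by rewrite opprD addrA; apply: subQ => //; apply: hvalP.
Qed.

End SubObject.

(** * Objects generated by a highest weight vector *)

Section Cyclic.
Variables (RS : rootSystem) (K : fieldType) (q : K) (lam : weight RS).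
Implicit Types (M N : gspace RS K) (mu nu : weight RS).

Definition pt M (v : M) : weight RS -> set M := fun mu x => mu = lam /\ x = v.

Definition wt_below M := forall mu (x : M), gcomp mu x -> x <> 0 -> le_weight mu lam.

(** The common description of S(lam) and L(lam): generation by [v] reflects that
   there is no proper subobject containing [v], the condition on [kerE] that
   there is no nonzero one avoiding it. Both kinds of objects are shown to be of this form
   and any two objects of this form are isomorphic. *)
Record cyclic_object M (v : M) : Prop := CyclicObject {
  co_gr : graded_ops M;
  co_X2 : X2 q M;
  co_wt : wt_below M;
  co_v : gcomp lam v;
  co_v0 : v <> 0;
  co_gen : forall mu (x : M), gcomp mu x -> fgen (pt v) mu x;
  co_ker : forall mu (x : M), mu <> lam -> kerE mu x -> x = 0 }.

Lemma wt_out M mu (x : M) : wt_below M -> ~ le_weight mu lam -> gcomp mu x -> x = 0.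
Proof. by move=> wM nle gx; apply: contrapT => /(wM mu x gx). Qed.

Lemma shift_above a n : (0 < n)%N -> ~ le_weight (shift lam a n) lam.
Proof.
move=> n0 h; apply: (shift_neq n0); apply: le_weight_anti h _; exact: le_shift.
Qed.

Lemma wt_above M a n (x : M) : wt_below M -> (0 < n)%N -> gcomp (shift lam a n) x -> x = 0.
Proof. by move=> wM n0; apply: wt_out (shift_above n0). Qed.

Lemma top_kerE M (x : M) : graded_maps M -> wt_below M -> gcomp lam x -> kerE lam x.
Proof.
move=> gM wM hx; split=> // a n n0; apply: (wt_above wM n0 (a := a)).
by have [_ _ h _] := gM.2 a n n0; apply: h.
Qed.

Lemma pt_gcomp M (v : M) mu x : gcomp lam v -> pt v mu x -> gcomp mu x.
Proof. by move=> hv [-> ->]. Qed.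

Lemma pt_kerE M (v : M) mu x : graded_maps M -> wt_below M -> gcomp lam v ->
  pt v mu x -> kerE mu x.
Proof. by move=> gM wM hv [-> ->]; apply: top_kerE. Qed.

Definition line M (v : M) : set M := fun x => exists c : K, x = c *: v.

Lemma line_subspace M (v : M) : subspace (line v).
Proof.
split=> [|c x y [d ->] [e ->]]; first by exists 0; rewrite scale0r.
by exists (c * d + e); rewrite scalerDl scalerA.
Qed.

Lemma zero_subspace M : subspace (fun x : M => x = 0).
Proof. by split=> // c x y -> ->; rewrite scaler0 addr0. Qed.

Lemma fgen_pt_top M (v : M) x : graded_maps M ->
  (forall a n y, (0 < n)%N -> gcomp (shift lam a n) y -> y = 0 :> M) ->
  gcomp lam v -> fgen (pt v) lam x -> line v x.
Proof.
move=> gM top hv; apply: (fgen_top gM) => //.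
- by move=> nu y; apply: pt_gcomp.
- exact: line_subspace.
by move=> y [_ ->]; exists 1; rewrite scale1r.
Qed.

Lemma fgen_pt_below M (v : M) mu x : graded_maps M ->
  fgen (pt v) mu x -> x <> 0 -> le_weight mu lam.
Proof.
move=> gM; elim=> {mu x} [mu x [-> _] _|mu|mu c x y _ hx _ hy|mu a n x n0 _ hx] //.
- exact: le_weight_refl.
- move=> ne; have [x0|] := pselect (x = 0); last exact: hx.
  apply: hy => y0; apply: ne; by rewrite x0 y0 scaler0 addr0.
move=> ne; apply: le_weight_trans (le_shift _ a n) (hx _).
by move=> x0; apply: ne; rewrite x0 gF_0.
Qed.

Lemma fgen_pt_lower M (v : M) mu x : mu <> lam -> fgen (pt v) mu x -> spanF (fgen (pt v)) mu x.
Proof.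
move=> ml /(fgen_split (zero_subspace M))[|y [z [-> hz ->]]]; first by move=> y [].
by rewrite add0r.
Qed.

Lemma pt_hull_all M (v : M) : cyclic_object v -> forall x, hull (fgen (pt v)) x.
Proof.
by move=> cM x; apply: hull_mono (co_gen cM) _ (hull_all (co_gr cM).1 x).
Qed.

Lemma hom_vanish M N (v : M) (f : M -> N) : cyclic_object v -> graded_maps N ->
  X_hom f -> f v = 0 -> forall x, f x = 0.
Proof.
move=> cM gN [flin _ fEF] fv x.
elim: (pt_hull_all cM x) => {x} [|c x y _ hx _ hy|mu x h].
- exact: linear_0.
- by rewrite flin hx hy scaler0 addr0.
elim: h => {mu x} [mu x [_ ->]|mu|mu c x y _ hx _ hy|mu a n x n0 _ hx] //.
- exact: linear_0.
- by rewrite flin hx hy scaler0 addr0.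
by have [_ ->] := fEF a n x n0; rewrite hx gF_0.
Qed.

Inductive inspan M (s : seq M) : M -> Prop :=
  | inspan_0 : inspan s 0
  | inspan_lin c x y : inspan s x -> inspan s y -> inspan s (c *: x + y)
  | inspan_in x : x \in s -> inspan s x.

Lemma inspan_coef M (s : seq M) x : inspan s x ->
  exists c : 'I_(size s) -> K, x = \sum_j c j *: s`_j.
Proof.
elim=> {x} [|c x y _ [d ->] _ [e ->]|x xs].
- by exists (fun=> 0); rewrite big1 // => j _; rewrite scale0r.
- exists (fun j => c * d j + e j); rewrite scaler_sumr -big_split.
  by apply: eq_bigr => j _; rewrite scalerDl scalerA.
have ix : (index x s < size s)%N by rewrite index_mem.
exists (fun j => (j == Ordinal ix)%:R).
rewrite (bigD1 (Ordinal ix)) //= eqxx scale1r nth_index // big1 ?addr0 // => j /negPf ->.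
by rewrite scale0r.
Qed.

(** Below [lam] a weight space is the sum of the images under F of higher weight
   spaces, finitely many of which are nonzero; induct on the height. *)
Lemma cyclic_spanned M (v : M) : cyclic_object v ->
  forall mu, exists s : seq M, forall x, gcomp mu x -> inspan s x.
Proof.
move=> cM; have gM := graded_ops_maps (co_gr cM); have wM := co_wt cM.
apply: (@ht_ind _ lam) => [mu nle|mu le IH].
  by exists [::] => x /(wt_out wM nle) ->; apply: inspan_0.
have [->|ml] := pselect (mu = lam).
  exists [:: v] => x /(co_gen cM)/(fgen_pt_top gM)[|| c ->].
  - by move=> a n y; apply: wt_above.
  - exact: co_v.
  by rewrite -[c *: v]addr0; apply: inspan_lin (inspan_0 _); apply: inspan_in; rewrite mem_head.
have [N hN] := le_weight_ht le.
pose s (p : simple RS * 'I_N) : seq M := sval (cid (IH p.1 p.2.+1 isT)).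
have hs (p : simple RS * 'I_N) (x : M) : gcomp (shift mu p.1 p.2.+1) x -> inspan (s p) x.
  exact: (svalP (cid (IH p.1 p.2.+1 isT))).
pose t (p : simple RS * 'I_N) : seq M := [seq gF p.1 p.2.+1 y | y <- s p].
exists (flatten [seq t p | p <- enum {: simple RS * 'I_N}]).
move=> x /(co_gen cM)/(fgen_pt_lower ml).
have sub nu y : fgen (pt v) nu y -> gcomp nu y.
  by apply: (fgen_gcomp gM) => {nu y} nu y; apply: pt_gcomp (co_v cM).
elim=> {x} [|c x y _ hx _ hy|a n x n0 /sub hx]; [exact: inspan_0 | exact: inspan_lin |].
have [x0|x0] := pselect (x = 0); first by rewrite x0 gF_0 //; apply: inspan_0.
have nN : (n.-1 < N)%N.
  by rewrite prednK //; apply: shift_bound hN (wM _ _ hx x0).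
pose p := (a, Ordinal nN); rewrite -(prednK n0) in hx *.
elim: (hs p x hx) => {x hx x0} [|c x y _ hx _ hy|x xs].
- by rewrite gF_0 //; apply: inspan_0.
- by rewrite (gF_lin gM) //; apply: inspan_lin.
apply: inspan_in; apply/flattenP; exists (t p).
  by apply/mapP; exists p; rewrite ?mem_enum.
by apply/mapP; exists x.
Qed.

Lemma cyclic_dim M (v : M) : cyclic_object v -> has_dim (@gcomp _ _ M lam) 1.
Proof.
move=> cM; exists (fun=> v); split=> [_|x /(co_gen cM)]; first exact: co_v.
move=> /(fgen_pt_top (graded_ops_maps (co_gr cM)))[|| c ->].
- by move=> a n y; apply: wt_above (co_wt cM).
- exact: co_v.
exists [ffun=> c]; split=> [|d]; first by rewrite big_ord1 ffunE.
rewrite big_ord1 => /eqP; rewrite -subr_eq0 -scalerBl scaler_eq0 => /orP[|/eqP /(co_v0 cM) //].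
by rewrite subr_eq0 => /eqP e; apply/ffunP => i; rewrite ffunE ord1.
Qed.

(** For (X3): in weight [lam] there is nothing above, so [imF] is 0 and all vectors
   are killed by E; in the other weights [kerE] is 0 and [imF] is everything. *)
Lemma cyclic_in_X M (v : M) : cyclic_object v -> in_X q M.
Proof.
move=> cM; have gM := graded_ops_maps (co_gr cM); have wM := co_wt cM.
split; [exact: co_gr cM| | exact: co_X2 cM|].
  split=> mu.
    apply: sub_finite_set (interval_finite lam mu) => nu [[x hx x0] le].
    by split=> //; apply: wM hx x0.
  have [s hs] := cyclic_spanned cM mu.
  apply: (@fin_dim _ _ M _ id (size s) (fun j => s`_j)) => //.
  - exact: gM.1.
  - by move=> x /hs/inspan_coef.
move=> mu; have [ml|ml] := pselect (mu = lam).
  split=> x.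
    split=> [hx|[y [z [[hy _] /(spanF_imF gM) hz ->]]]].
      exists x, 0; rewrite addr0; split=> //; first by rewrite ml; apply: top_kerE => //; rewrite -ml.
      by apply/(spanF_imF gM); apply: spanF_0.
    by apply: gcompD => //; apply: spanF_gcomp.
  move=> _ /(spanF_imF gM); rewrite ml; elim=> {x} [//|c x y _ -> _ ->|a n x n0 hx].
    by rewrite scaler0 addr0.
  by rewrite (wt_above wM n0 hx) gF_0.
split=> x; last by move=> /(co_ker cM ml).
split=> [hx|[y [z [[hy _] /(spanF_imF gM) hz ->]]]].
  exists 0, x; rewrite add0r; split=> //.
    by split; [have [] := gM.1 mu | move=> a n n0; rewrite gE_0].
  apply/(spanF_imF gM); apply: spanF_mono (fgen_pt_lower ml (co_gen cM hx)) => nu y.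
  by apply: (fgen_gcomp gM) => {nu y} nu y; apply: pt_gcomp (co_v cM).
by apply: gcompD => //; apply: spanF_gcomp.
Qed.

(** For indecomposability, write [c v] for the image of [v] under the idempotent of
   the summand [A]. If [c = 0] the projection to [A] kills the generator [v],
   otherwise the one to [B] does. *)
Lemma cyclic_is_S M (v : M) : cyclic_object v -> is_S q lam M.
Proof.
move=> cM; have gM := graded_ops_maps (co_gr cM); split; last exact: co_wt cM.
- exact: cyclic_in_X cM.
- split; first by move=> /(_ v) /(co_v0 cM).
  move=> A B [gA _ _ _] [gB _ _ _] [iA [pA [iB [pB [[hiA hpA hiB hpB] kA kB [AB BA] sum]]]]].
  have [iAl iAg _] := hiA; have [pAl pAg _] := hpA.
  have [_ pBg _] := hpB; have [pBl _ _] := hpB.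
  have /(co_gen cM)/(fgen_pt_top gM)[|| c hc] := iAg _ _ (pAg _ _ (co_v cM)).
  - by move=> a n y; apply: wt_above (co_wt cM).
  - exact: co_v.
  have [c0|c0] := eqVneq c 0.
    left=> y; have pv : pA v = 0 by rewrite -[pA v]kA hc c0 scale0r (linear_0 pAl).
    by rewrite -[y]kA; apply: (hom_vanish cM (graded_ops_maps gA)).
  right=> y; have pv : pB v = 0.
    have -> : v = c^-1 *: (c *: v) + 0 by rewrite addr0 scalerA mulVf ?scale1r.
    by rewrite -hc pBl BA scaler0 add0r (linear_0 pBl).
  by rewrite -[y]kB; apply: (hom_vanish cM (graded_ops_maps gB)).
exact: cyclic_dim cM.
Qed.

(** The F-spans of [v] and of the vectors killed by E in weights other than [lam]
   are stable under E and F. They span [M] by (X3) and downward induction. A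
   vector of maximal weight in their intersection is killed by E; it lies in
   [imF] if its weight is not [lam], hence is 0, and in weight [lam] the second
   span is 0. So they are complementary subobjects, and indecomposability makes
   the second one vanish. *)
Lemma is_S_cyclic M : is_S q lam M -> exists v : M, cyclic_object v.
Proof.
move=> [MX [nz indec] [b [bl hb]] wM].
have [Mgr _ M2 M3] := MX; have gM := graded_ops_maps Mgr.
pose v := b ord0; have vl : gcomp lam v by apply: bl.
have Mlam x : gcomp lam x -> line v x.
  by move=> /hb[c [-> _]]; exists (c ord0); rewrite big_ord1.
have v0 : v <> 0.
  move=> v0; have [c [_ uc]] := hb 0 (gM.1 lam).1.
  have c1 : c = [ffun=> 1] by apply: uc; rewrite big_ord1 -/v v0 scaler0.
  have c2 : c = [ffun=> 0] by apply: uc; rewrite big_ord1 -/v v0 scaler0.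
  have := congr1 (fun f : {ffun 'I_1 -> K} => f ord0) c1; rewrite c2 !ffunE => /eqP.
  by rewrite eq_sym oner_eq0.
pose G mu x := kerE mu x /\ (mu = lam -> x = 0 :> M).
have GK mu x : G mu x -> kerE mu x by case.
have ptK mu x : pt v mu x -> kerE mu x by apply: pt_kerE.
have kS mu : subspace (@kerE _ _ M mu).
  split=> [|c x y [hx ex] [hy ey]].
    by split=> [|a n n0]; [exact: (gM.1 mu).1 | rewrite gE_0].
  split=> [|a n n0]; first by have [_] := gM.1 mu; apply.
  by rewrite (gE_lin gM a n0) ex // ey // scaler0 addr0.
have fam (H : weight RS -> set M) : (forall mu x, H mu x -> kerE mu x) -> subfamily (fgen H).
  move=> HK; split.
  - by move=> mu; apply: fgen_subspace.
  - by move=> mu x; apply: (fgen_gcomp gM) => nu y /HK[].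
  - by move=> mu a n x n0; apply: (fgen_E gM M2 HK).
  - by move=> *; apply: fgen_F.
  move=> mu x /(fgen_split (R := fun y => kerE mu y /\ fgen H mu y))[||y [z [[h1 h2] h3 h4]]].
  - split=> [|c y z [h1 h2] [h3 h4]]; first by split; [exact: (kS mu).1 | apply: fgen_0].
    by split; [apply: (kS mu).2 | apply: fgen_lin].
  - by move=> y Hy; split; [apply: HK | apply: fgen_in].
  by exists y, z.
have famv := fam _ ptK; have famG := fam _ GK.
have disj : forall mu x, fgen (pt v) mu x -> fgen G mu x -> x = 0.
  apply: (@ht_ind _ lam) => [mu nle x hx _|mu le IH x hx hG].
    by apply: (wt_out wM nle); apply: (sf_comp famv).
  have [ml|ml] := pselect (mu = lam).
    move: hG; rewrite ml; apply: (fgen_top (R := fun y => y = 0) gM) => //.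
    - by move=> nu y /GK[].
    - by move=> a n y; apply: wt_above.
    - exact: zero_subspace.
    by move=> y [_]; apply.
  have kx : kerE mu x.
    split=> [|a n n0]; first exact: (sf_comp famv).
    by apply: (IH a n n0); apply: (fgen_E gM M2).
  have [_ M30] := M3 mu; apply: M30 kx _; apply/(spanF_imF gM).
  apply: spanF_mono (fgen_pt_lower ml hx) => nu y; exact: (sf_comp famv).
have span_all : forall mu x, gcomp mu x ->
    exists a b, [/\ fgen (pt v) mu a, fgen G mu b & x = a + b].
  have zero mu : exists a b, [/\ fgen (pt v) mu a, fgen G mu b & 0 = a + b :> M].
    by exists 0, 0; rewrite addr0; split=> //; apply: fgen_0.
  apply: (@ht_ind _ lam) => [mu nle x /(wt_out wM nle) -> //|mu le IH x hx].
  have [M3s _] := M3 mu; have /M3s[y [z [ky /(spanF_imF gM) hz ->]]] := hx.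
  have lin c x1 x2 : (exists a b, [/\ fgen (pt v) mu a, fgen G mu b & x1 = a + b]) ->
      (exists a b, [/\ fgen (pt v) mu a, fgen G mu b & x2 = a + b]) ->
      exists a b, [/\ fgen (pt v) mu a, fgen G mu b & c *: x1 + x2 = a + b].
    move=> [a1 [b1 [h1 h2 ->]]] [a2 [b2 [h3 h4 ->]]].
    exists (c *: a1 + a2), (c *: b1 + b2).
    by split; [apply: fgen_lin|apply: fgen_lin|rewrite scalerDr addrACA].
  rewrite -[y]scale1r; apply: (lin).
    have [ml|ml] := pselect (mu = lam).
      have [hy _] := ky; move: hy; rewrite ml => /Mlam[c ->]; exists (c *: v), 0.
      rewrite addr0; split=> //; last exact: fgen_0.
      by rewrite -[_ *: v]addr0; apply: fgen_lin (fgen_0 _ _); apply: fgen_in.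
    by exists 0, y; rewrite add0r; split=> //; [apply: fgen_0 | apply: fgen_in].
  elim: hz => {z} [|c z1 z2 _ h1 _ h2|a n z n0 hz]; [exact: zero|exact: lin|].
  have [z1 [z2 [h1 h2 ->]]] := IH a n n0 z hz.
  exists (gF a n z1), (gF a n z2); split; try exact: fgen_F.
  by rewrite -[z1]scale1r (gF_lin gM a n0) !scale1r.
have bip := family_biproduct MX famv famG disj span_all.
have [||A0|B0] := indec _ _ _ _ bip; try exact: (subg_in_X MX).
  have hv : hull (fgen (pt v)) v by apply: (@hull_in _ _ _ _ lam); apply: fgen_in.
  by case: v0; rewrite -(hvalK hv) [hinj _ v]A0 hval0.
have G0 mu x : fgen G mu x -> x = 0.
  by move=> /hull_in hx; rewrite -(hvalK hx) [hinj _ x]B0 hval0.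
exists v; split=> //.
  by move=> mu x /span_all[a [c [ha /G0 -> ->]]]; rewrite addr0.
by move=> mu x ml kx; apply: (G0 mu); apply: fgen_in; split.
Qed.

(** * Uniqueness of cyclic objects *)

Definition gprod M N : gspace RS K := @GSpace RS K (M * N)%type
  (fun mu p => gcomp mu p.1 /\ gcomp mu p.2)
  (fun a n p => (gE a n p.1, gE a n p.2)) (fun a n p => (gF a n p.1, gF a n p.2)).

Lemma gprod_maps M N : graded_maps M -> graded_maps N -> graded_maps (gprod M N).
Proof.
move=> gM gN; split=> [mu|a n n0].
  have [M0 Ml] := gM.1 mu; have [N0 Nl] := gN.1 mu.
  by split=> [//|c x y [h1 h2] [h3 h4]]; split; [apply: Ml | apply: Nl].
have [E1 F1 S1 T1] := gM.2 a n n0; have [E2 F2 S2 T2] := gN.2 a n n0; split.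
- by move=> c x y; rewrite /= E1 E2.
- by move=> c x y; rewrite /= F1 F2.
- by move=> mu x [h1 h2]; split; [apply: S1 | apply: S2].
by move=> mu x [h1 h2]; split; [apply: T1 | apply: T2].
Qed.

Lemma gprod_X2 M N : X2 q M -> X2 q N -> X2 q (gprod M N).
Proof.
move=> hM hN mu a b m n [x y] m0 n0 [hx hy].
have [M1 M2] := hM mu a b m n x m0 n0 hx; have [N1 N2] := hN mu a b m n y m0 n0 hy.
split=> ab /=; first by rewrite M1 // N1.
rewrite M2 // N2 //.
have e0 k (p : gprod M N) : gE0 a k p = (gE0 a k p.1, gE0 a k p.2) by case: k p => [|k] [].
have f0 k (p : gprod M N) : gF0 a k p = (gF0 a k p.1, gF0 a k p.2) by case: k p => [|k] [].
rewrite [RHS]surjective_pairing; congr (_, _).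
  rewrite (raddf_sum (@fst M N)); apply: eq_bigr => r _ /=.
  by rewrite f0 e0.
rewrite (raddf_sum (@snd M N)); apply: eq_bigr => r _ /=.
by rewrite f0 e0.
Qed.

(** By downward induction E maps such a [y] to 0. In weights other than [lam] this
   forces [y = 0]; in weight [lam] the span is the line of [(v, w)]. *)
Lemma graph_uniq M N (v : M) (w : N) : cyclic_object v -> cyclic_object w ->
  forall mu (y : N), fgen (pt ((v, w) : gprod M N)) mu ((0, y) : gprod M N) -> y = 0.
Proof.
move=> cM cN; have gM := graded_ops_maps (co_gr cM); have gN := graded_ops_maps (co_gr cN).
have gP := gprod_maps gM gN; have P2 := gprod_X2 (co_X2 cM) (co_X2 cN).
have vw : gcomp lam ((v, w) : gprod M N) by split; [apply: co_v cM | apply: co_v cN].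
have wP : wt_below (gprod M N).
  move=> mu [x y] [hx hy] ne; have [x0|x0] := pselect (x = 0).
    apply: (co_wt cN hy) => y0; apply: ne.
    by move: x0 y0 => /= -> ->.
  exact: (co_wt cM hx).
have ptK mu x : pt ((v, w) : gprod M N) mu x -> kerE mu x by apply: pt_kerE.
apply: (@ht_ind _ lam) => [mu nle y h|mu le IH y h].
  have /= [_ hy] := fgen_gcomp gP (fun _ _ => @pt_gcomp _ _ _ _ vw) h.
  exact: wt_out (co_wt cN) nle hy.
have [ml|ml] := pselect (mu = lam).
  move: h; rewrite ml => /(fgen_pt_top gP)[||c [/esym/eqP + ->]] //.
    by move=> a n p; apply: wt_above.
  rewrite scaler_eq0 => /orP[/eqP ->|/eqP /(co_v0 cM) //].
  by rewrite scale0r.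
apply: (co_ker cN ml); split.
  by have [] := fgen_gcomp gP (fun _ _ => @pt_gcomp _ _ _ _ vw) h.
move=> a n n0; apply: (IH a n n0).
by have /= := fgen_E gP P2 ptK a n0 h; rewrite (gE_0 gM).
Qed.

(** Generated by [(v, w)], hence stable under E and F; it is the graph of the
   isomorphism. *)
Definition graph M N (v : M) (w : N) x y : Prop :=
  hull (fgen (pt ((v, w) : gprod M N))) ((x, y) : gprod M N).

Lemma graph_sym M N (v : M) (w : N) x y : graph v w x y -> graph w v y x.
Proof.
have fsym mu (p : gprod M N) : fgen (pt ((v, w) : gprod M N)) mu p ->
    fgen (pt ((w, v) : gprod N M)) mu ((p.2, p.1) : gprod N M).
  elim=> {mu p} [mu p [-> ->]|mu|mu c p p' _ h _ h'|mu a n p n0 _ h].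
  - exact: fgen_in.
  - exact: fgen_0.
  - exact: (fgen_lin c h h').
  exact: (fgen_F n0 h).
suff hsym (p : gprod M N) : hull (fgen (pt ((v, w) : gprod M N))) p ->
    hull (fgen (pt ((w, v) : gprod N M))) ((p.2, p.1) : gprod N M) by move/hsym.
elim=> {p} [|c p p' _ h _ h'|mu p /fsym h]; first exact: hull_0.
  exact: (hull_lin c h h').
exact: hull_in h.
Qed.

Lemma graph_inj M N (v : M) (w : N) : cyclic_object v -> cyclic_object w ->
  forall x y y', graph v w x y -> graph v w x y' -> y = y'.
Proof.
move=> cM cN x y y' h h'; have [dM _] := co_gr cM; have [dN _] := co_gr cN.
have gP := gprod_maps (graded_ops_maps (co_gr cM)) (graded_ops_maps (co_gr cN)).
have hpr (p : gprod M N) : hull (fgen (pt ((v, w) : gprod M N))) p ->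
    forall mu, fgen (pt ((v, w) : gprod M N)) mu ((pr dM mu p.1, pr dN mu p.2) : gprod M N).
  elim=> {p} [|c p p' _ hp _ hp'|nu p hp] mu.
  - by rewrite /= !pr0; apply: fgen_0.
  - by rewrite /= !pr_linear; apply: (fgen_lin c (hp mu) (hp' mu)).
  have [h1 h2] : gcomp nu p.
    apply: (fgen_gcomp gP) hp => {nu p} nu p [-> ->].
    by split; [apply: co_v cM | apply: co_v cN].
  have [->|mn] := eqVneq mu nu; first by rewrite !pr_id //; case: (p) hp.
  by rewrite (pr_neq dM h1 mn) (pr_neq dN h2 mn); apply: fgen_0.
have : graph v w 0 (y - y').
  have := hull_lin (-1) h' h; congr (hull _ _); congr (_, _) => /=.
    by rewrite scaleN1r addNr.
  by rewrite scaleN1r addrC.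
move=> /hpr/= hy; apply/eqP; rewrite -subr_eq0; apply/eqP.
have [s ->] := pr_sum dN (y - y'); apply: big1 => mu _.
by apply: (graph_uniq cM cN (mu := mu)); have := hy mu; rewrite pr0.
Qed.

Lemma graph_hom M N (v : M) (w : N) : cyclic_object v -> cyclic_object w ->
  exists f : M -> N, X_hom f /\ forall x, graph v w x (f x).
Proof.
move=> cM cN; have inj := graph_inj cM cN.
have gM := graded_ops_maps (co_gr cM); have gN := graded_ops_maps (co_gr cN).
have gP := gprod_maps gM gN; have P2 := gprod_X2 (co_X2 cM) (co_X2 cN).
have vw : gcomp lam ((v, w) : gprod M N) by split; [apply: co_v cM | apply: co_v cN].
have homog mu x : gcomp mu x -> exists y, fgen (pt ((v, w) : gprod M N)) mu ((x, y) : gprod M N).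
  move=> /(co_gen cM); elim=> {mu x} [mu x [-> ->]|mu|mu c x y _ [x' hx] _ [y' hy]|mu a n x n0 _ [y hy]].
  - by exists w; apply: fgen_in.
  - by exists 0; apply: fgen_0.
  - by exists (c *: x' + y'); apply: (fgen_lin c hx hy).
  by exists (gF a n y); apply: (fgen_F n0 hy).
have ex x : exists y, graph v w x y.
  elim: (hull_all (co_gr cM).1 x) => {x} [|c x y _ [x' hx] _ [y' hy]|mu x /homog[y hy]].
  - by exists 0; apply: hull_0.
  - by exists (c *: x' + y'); apply: (hull_lin c hx hy).
  by exists y; apply: hull_in hy.
pose f x := sval (cid (ex x)).
have fP x : graph v w x (f x) by apply: (svalP (cid (ex x))).
have ptK mu x : pt ((v, w) : gprod M N) mu x -> kerE mu x.
  move=> [-> ->]; split=> // a n n0 /=.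
  have [_ -> //] := top_kerE gM (co_wt cM) (co_v cM).
  by have [_ -> //] := top_kerE gN (co_wt cN) (co_v cN).
exists f; split=> //; split=> [c x y|mu x hx|a n x n0].
- by apply: (inj (c *: x + y)) (fP _) _; apply: (hull_lin c (fP x) (fP y)).
- have [y hy] := homog mu x hx; rewrite (inj x (f x) y (fP x) (hull_in hy)).
  by have [] := fgen_gcomp gP (fun _ _ => @pt_gcomp _ _ _ _ vw) hy.
split; apply: (inj _ _ _ (fP _)).
  apply: (@hull_E _ _ _ gP (fgen (pt ((v, w) : gprod M N))) _ a n _ n0 (fP x)).
  by move=> mu b k p k0; apply: (fgen_E gP P2 ptK).
apply: (@hull_F _ _ _ gP (fgen (pt ((v, w) : gprod M N))) _ a n _ n0 (fP x)).
move=> mu b k p k0 hp.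
by apply: (@hull_in _ _ _ _ (mu - sroot b *+ k)); apply: fgen_F => //; rewrite /shift subrK.
Qed.

Lemma cyclic_iso M N (v : M) (w : N) : cyclic_object v -> cyclic_object w -> X_iso M N.
Proof.
move=> cM cN; have [f [fh fP]] := graph_hom cM cN; have [g [gh gP]] := graph_hom cN cM.
exists f, g; split=> // x.
  by apply: (graph_inj cN cM (gP (f x))); apply: graph_sym.
by apply: (graph_inj cM cN (fP (g x))); apply: graph_sym.
Qed.

End Cyclic.

(** * Irreducible highest weight modules *)

Section IrreducibleModule.
Variables (RS : rootSystem) (K : fieldType) (q : K).
Hypothesis q_neq0 : q != 0.
Variables (lam : weight RS) (L : lmodType (Uq RS q)).
Local Notation M := (gspace_of L).
Hypothesis wL : weight_module L.

Let Mgr : graded_ops M := gspace_of_graded q_neq0 wL.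
Let gM : graded_maps M := graded_ops_maps Mgr.
Let M2 : X2 q M := @gspace_of_X2 _ _ _ q_neq0 L.

(** The divided powers and the Cartan generators generate U over K, so a
   subspace spanned by weight vectors and stable under E and F is a submodule. *)
Lemma hull_submodule (P : weight RS -> set M) :
  (forall mu x, P mu x -> gcomp mu x) ->
  (forall mu a n x, (0 < n)%N -> P mu x -> P (shift mu a n) (gE a n x)) ->
  (forall mu a n x, (0 < n)%N -> P (shift mu a n) x -> P mu (gF a n x)) ->
  forall u (x : M), hull P x -> hull P (Uact u x).
Proof.
move=> PM PE PF.
have hE a n x : (0 < n)%N -> hull P x -> hull P (gE a n x) by move=> n0; apply: hull_E.
have hF a n x : (0 < n)%N -> hull P x -> hull P (gF a n x).
  move=> n0; apply: (hull_F gM) n0 => {a n x} mu a n x n0 hx.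
  apply: (@hull_in _ _ _ _ (mu - sroot a *+ n)); apply: PF => //.
  by rewrite /shift subrK.
have [_ Pl] := hull_subspace P.
have hZ c x : hull P x -> hull P (c *: x).
  by move=> hx; rewrite -[c *: x]addr0; apply: Pl => //; apply: hull_0.
have hK (w : Uq RS q) : (forall mu (x : M), gcomp mu x -> exists c : K, Uact w x = c *: x) ->
    forall x, hull P x -> hull P (Uact w x).
  move=> hw x; elim=> {x} [|c x y _ hx _ hy|mu x hx].
  - by rewrite linear0; apply: hull_0.
  - by rewrite linearP; apply: Pl.
  by have [c ->] := hw mu x (PM _ _ hx); apply/hZ/hull_in/hx.
have key y : zgen (@UZ_gens RS) y -> forall x : M, hull P x -> hull P (act y x).
  elim=> {y} [y [a hy]||y y' hy IHy hy' IHy'|y y' hy IHy hy' IHy'|z y hz hy IHy] x hx.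
  - case: hy => [[n n0 ->]|[n n0 ->]|->|->].
    + by rewrite /act -Ue_spec; apply: hE.
    + by rewrite /act -Uf_spec; apply: hF.
    + by apply: hK hx => mu z /(wtvecP q_neq0)/(_ a)[h _ _]; eexists; exact: h.
    by apply: hK hx => mu z /(wtvecP q_neq0)/(_ a)[_ h _]; eexists; exact: h.
  - by rewrite act1.
  - by rewrite actD // -[act y x]scale1r; apply: Pl; [apply: IHy | apply: IHy'].
  - by rewrite actM //; apply: IHy; apply: IHy'.
  by rewrite actZ //; apply: hZ; apply: IHy.
move=> u x hx; elim/tclW: u => s; rewrite tcl_sum.
elim: s => [|y s IH].
  by rewrite big_nil [Uact 0 x](scale0r (x : L)); apply: hull_0.
rewrite big_cons UactD UactZ -specE; apply: Pl IH; exact: key (zvalP _) _ hx.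
Qed.

Lemma hull_fgen_submodule (G : weight RS -> set M) : (forall mu x, G mu x -> kerE mu x) ->
  forall u (x : M), hull (fgen G) x -> hull (fgen G) (Uact u x).
Proof.
move=> GK; apply: hull_submodule.
- by move=> mu x; apply: (fgen_gcomp gM) => nu y /GK[].
- by move=> mu a n x n0; apply: (fgen_E gM M2 GK).
by move=> *; apply: fgen_F.
Qed.

(** The E and F make the span of the F-words on [v] a submodule, hence all of [L].
   A nonzero [x] in [kerE] likewise generates [L] under the F, so [lam] lies
   below the weight of [x], which lies below [lam]. *)
Lemma is_L_cyclic : is_L lam L -> exists v : M, cyclic_object q lam v.
Proof.
move=> [_ [_ irr] [v [v0 vl vE vgen]]]; exists (v : M).
have ptK mu x : pt lam (v : M) mu x -> kerE mu x.
  by move=> [-> ->]; split=> // a n n0; apply: vE.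
have PM mu x : fgen (pt lam (v : M)) mu x -> gcomp mu x.
  by apply: (fgen_gcomp gM) => nu y /ptK[].
have gen mu x : gcomp mu x -> fgen (pt lam (v : M)) mu x.
  move=> hx; have [dM _] := Mgr; apply: (hull_homog dM (fun nu => fgen_subspace _ nu) PM hx).
  have [u ->] := vgen x; apply: (hull_fgen_submodule ptK u).
  by apply: (@hull_in _ _ _ _ lam); apply: fgen_in.
have wM : wt_below lam M by move=> mu x /gen; apply: (fgen_pt_below gM).
split=> // mu x ml kx; apply: contrapT => x0; apply: ml.
have [mux _] := kx; have ptK' nu y : pt mu (x : M) nu y -> kerE nu y by move=> [-> ->].
have PM' nu y : fgen (pt mu x) nu y -> gcomp nu y.
  by apply: (fgen_gcomp gM) => {nu y} nu y /ptK'[].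
apply: le_weight_anti; first exact: wM mux x0.
case: (irr (hull (fgen (pt mu x)))).
- exact: hull_0.
- by move=> m m' hm hm'; have := hull_lin 1 hm hm'; rewrite scale1r.
- exact: hull_fgen_submodule ptK'.
- move=> /(_ x) h; case: x0; apply: h.
  by apply: (@hull_in _ _ _ _ mu); apply: fgen_in.
move=> /(_ v) hv; apply: (fgen_pt_below gM _ v0).
by have [dM _] := Mgr; apply: (hull_homog dM (fun nu => fgen_subspace _ nu) PM' vl hv).
Qed.

End IrreducibleModule.

Theorem theoremD (RS : rootSystem) (RS_sl : simply_laced RS)
    (K : fieldType) (q : K) (q_neq0 : q != 0)
    (lam : weight RS) (L : lmodType (Uq RS q)) (L_lam : is_L lam L) :
  in_X q (gspace_of L) /\
  is_S q lam (gspace_of L) /\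
  (forall S : gspace RS K, is_S q lam S -> X_iso (gspace_of L) S).
Proof.
have [wL _ _] := L_lam; have [v cL] := is_L_cyclic q_neq0 wL L_lam.
split; first exact: cyclic_in_X cL.
split=> [|S /is_S_cyclic[w cS]]; first exact: cyclic_is_S cL.
exact: cyclic_iso cL cS.
Qed.
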